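(* Suppose Assumptions 1, 2 and 4 (stated in the context) hold, and define $$\omega_2 := \max\left\{\frac{96\sqrt n}{\eta\, c_{\rm all}^2},\ \|x^0\|_\infty\right\},$$ $$\bar K_2 := \left\lceil \frac{1536\left(f(x^0)-f_{\rm low}+\mu n\left(\log(\omega_2)-\min_i\log(x^0_i)\right)\right)}{\eta\, c_{\rm all}^3}\,\epsilon_g^{-3/2}\right\rceil + 2 .$$ Then $\bar K_2=\tilde{\mathcal O}(n\epsilon_g^{-1/2}+\epsilon_g^{-3/2})$. With probability at least $(1-\delta)^{\bar K_2}$, Algorithm LBNCG terminates in at most $\bar K_2$ iterations at a point $x$ satisfying $$x>0,\qquad \nabla f(x)\ge -\epsilon_g e,\qquad \|\bar X\nabla f(x)\|_\infty\le \epsilon_g,\qquad \bar X\nabla^2 f(x)\bar X\succeq -\epsilon_H I .$$ (With probability at most $1-(1-\delta)^{\bar K_2}$, it terminates incorrectly within $\bar K_2$ iterations at a point $x$ for which $x>0$, $\nabla f(x)\ge-\epsilon_g e$ and $\|\bar X\nabla f(x)\|_\infty\le\epsilon_g$ hold but $\bar X\nabla^2 f(x)\bar X\succeq-\epsilon_H I$ does not.)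
   Context: Problem and notation. The problem is to minimize $f(x)$ subject to $x\ge 0$, with $f:\mathbb R^n\to\mathbb R$. $\|\cdot\|$ is the Euclidean norm (or induced matrix norm), $e=(1,\dots,1)^\top$, $\lambda_{\min}$ is the smallest eigenvalue. For $x>0$ (componentwise): $X=\mathrm{diag}(x)$, $\bar x$ is the vector with components $\min(x_i,1)$, $\bar X=\mathrm{diag}(\bar x)$; $X_k,\bar X_k$ are these matrices at $x^k$. For $\mu>0$, $\phi_\mu(x)=f(x)-\mu\sum_{i=1}^n\log x_i$, so $\nabla\phi_\mu(x)=\nabla f(x)-\mu X^{-1}e$ and $\nabla^2\phi_\mu(x)=\nabla^2f(x)+\mu X^{-2}$. Algorithm CCG (Capped Conjugate Gradient). Inputs: symmetric $H\in\mathbb R^{n\times n}$, $g\ne0$, $\epsilon\in(0,1)$, $\zeta_r\in(0,1)$, $c_\mu\in(0,1)$, and $M\ge0$. Set $\bar H=H+2\epsilon I$, $\kappa=(M+2\epsilon)/\epsilon$, $\hat\zeta_r=\zeta_r/(3\kappa)$, $\tau=\sqrt\kappa/(\sqrt\kappa+1)$, $T=4\kappa^4/(1-\sqrt\tau)^2$; whenever $M$ is changed, $\kappa,\hat\zeta_r,\tau,T$ are recomputed. Set $y^0=0$, $r^0=g$, $p^0=-g$, $j=0$. If $(p^0)^\top\bar Hp^0<\epsilon\|p^0\|^2$, return $d=p^0$ with d_type=NC; else if $\|Hp^0\|>M\|p^0\|$ set $M\leftarrow\|Hp^0\|/\|p^0\|$. Then repeat: $a_j=\|r^j\|^2/((p^j)^\top\bar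 Hp^j)$, $y^{j+1}=y^j+a_jp^j$, $r^{j+1}=r^j+a_j\bar Hp^j$, $b_{j+1}=\|r^{j+1}\|^2/\|r^j\|^2$, $p^{j+1}=-r^{j+1}+b_{j+1}p^j$; $j\leftarrow j+1$; for the first $z$ in the order $p^j,y^j,r^j$ (if any) with $\|Hz\|>M\|z\|$, set $M\leftarrow\|Hz\|/\|z\|$; then apply the first applicable test: (1) if $(y^j)^\top\bar Hy^j<\epsilon\|y^j\|^2$ return $d=y^j$, d_type=NC; (2) if $\|r^j\|\le\hat\zeta_r\|r^0\|$ and $\|r^j\|_\infty\le c_\mu$ return $d=y^j$, d_type=SOL; (3) if $(p^j)^\top\bar Hp^j<\epsilon\|p^j\|^2$ return $d=p^j$, d_type=NC; (4) if $\|r^j\|>\sqrt T\tau^{j/2}\|r^0\|$, compute $a_j=\|r^j\|^2/((p^j)^\top\bar Hp^j)$ and $y^{j+1}=y^j+a_jp^j$, find $i\in\{0,\dots,j-1\}$ with $(y^{j+1}-y^i)^\top\bar H(y^{j+1}-y^i)<\epsilon\|y^{j+1}-y^i\|^2$, and return $d=y^{j+1}-y^i$, d_type=NC. Procedure MEO (minimum eigenvalue oracle). Inputs: symmetric $H$, $\epsilon>0$, optionally $M\ge\|H\|$. Output: either $\lambda\le-\epsilon/2$ and $v$ with $\|v\|=1$, $v^\top Hv=\lambda$ ($\lambda$ an estimate of $\lambda_{\min}(H)$), or a certificate that $\lambda_{\min}(H)\ge-\epsilon$; when output, the certificate is false with probability at most $\delta\in[0,1)$ (conditionally on the history up to that call).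 Algorithm LBNCG (Log-Barrier Newton-CG). Inputs: $\epsilon_g\in(0,1)$, $\theta\in(0,1)$, $x^0>0$, $\zeta_r\in(0,1)$, $\bar\zeta\in(0,1)$, $\beta\in[\epsilon_g^{1/2},1)$, $\eta\in(0,1)$; optionally $\hat M>0$ with $\|\nabla^2f(x)\|\le\hat M$ for all $x$ ($\hat M=0$ if not provided). Set $\epsilon_H=\epsilon_g^{1/2}$, $\mu=\epsilon_g/4$, $c_\mu=\bar\zeta\mu$, $M_\mu=\hat M+\mu$. For $k=0,1,2,\dots$: (i) If $[\nabla f(x^k)]_i\le-\epsilon_g$ for some $i$ or $\|\bar X_k\nabla f(x^k)\|_\infty>\epsilon_g$: call CCG with $H=\bar X_k\nabla^2\phi_\mu(x^k)\bar X_k$, $\epsilon=\epsilon_H$, $g=\bar X_k\nabla\phi_\mu(x^k)$, $\zeta_r$, $c_\mu$, $M=M_\mu$, obtaining $\hat d^k$ and d_type. If d_type=NC, $d^k=-\mathrm{sgn}(g^\top\hat d^k)\min\{|(\hat d^k)^\top H\hat d^k|/\|\hat d^k\|^3,\ \beta/\|X_k^{-1}\bar X_k\hat d^k\|_\infty\}\hat d^k$; if d_type=SOL, $d^k=\min\{1,\beta/\|X_k^{-1}\bar X_k\hat d^k\|_\infty\}\hat d^k$. (ii) Otherwise call MEO with $H=\bar X_k\nabla^2f(x^k)\bar X_k$, $\epsilon=\epsilon_H$, $M=\hat M$ (if provided). If it certifies $\lambda_{\min}(\bar X_k\nabla^2f(x^k)\bar X_k)\ge-\epsilon_H$, terminate;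 otherwise with the returned $v$ set $d^k=-\mathrm{sgn}(v^\top\bar X_k\nabla\phi_\mu(x^k))\min\{|v^\top\bar X_k\nabla^2\phi_\mu(x^k)\bar X_kv|,\ \beta/\|X_k^{-1}\bar X_kv\|_\infty\}v$. (iii) Line search: $\alpha_k=\theta^{j_k}$ with $j_k$ the smallest nonnegative integer such that $\phi_\mu(x^k+\alpha_k\bar X_kd^k)<\phi_\mu(x^k)-\frac\eta6\alpha_k^3\|d^k\|^3$; set $x^{k+1}=x^k+\alpha_k\bar X_kd^k$. Convention: $\mathrm{sgn}(0)\in\{-1,1\}$. Assumption 1: $f$ is twice uniformly Lipschitz continuously differentiable on an open neighborhood of the path of the iterates and trial points (a set containing the segments joining each $x^k$ to its trial points $x^k+\theta^j\bar X_kd^k$); $L_g$, $L_H>0$ are Lipschitz constants of $\nabla f$, $\nabla^2f$ there. Assumption 2: $f$ is bounded below by $f_{\rm low}$. Assumption 4: for every iteration $k$ at which LBNCG calls MEO, and for a specified failure probability $\delta$ with $0\le\delta\ll1$, MEO either certifies that $\bar X_k\nabla^2f(x^k)\bar X_k\succeq-\epsilon_HI$ or finds a vector of curvature smaller than $-\epsilon_H/2$ in at most $N_{\rm meo}:=\min\{n,1+\lceil\mathcal C_{\rm meo}\epsilon_H^{-1/2}\rceil\}$ Hessian-vector products, with probability $1-\delta$, where $\mathcal C_{\rm meo}$ depends at most logarithmically on $\delta$ and $\epsilon_H$. Constants: $c_d=\min\{\frac{1-\bar\zeta}9,(\frac3{2L_H})^{1/2},\frac1{2(L_H+9/2+\zeta_r)}\}$,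 $c_{\rm sol}=\min\{c_d,\frac{6(1-\beta)^2\theta^2}{(L_H+\eta)(1-\beta)^2+(2-\beta)}\}$, $c_{\rm nc}=\min\{1,\frac{3(1-\beta)^2\theta}{(L_H+\eta)(1-\beta)^2+(2-\beta)}\}$, $c_{\rm all}=\min\{c_{\rm sol},c_{\rm nc}\}$. $\tilde{\mathcal O}$ is $\mathcal O$ with logarithmic factors omitted, displaying dependence on $n$ and $\epsilon_g$ (other problem and algorithm quantities are treated as constants).
   Formalization: In CCG test (4), if no index i with the required curvature exists (possible when only the first violating z resets M), the test is taken not to apply and the loop continues; the stated algorithm is undefined there. *)

(* Defs.v *)
From mathcomp Require Import all_boot all_order all_algebra.
From mathcomp Require Import all_classical all_reals all_analysis.

Set Implicit Arguments.
Unset Strict Implicit.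
Unset Printing Implicit Defensive.

Import Order.TTheory GRing.Theory Num.Theory.
Import numFieldNormedType.Exports.
Local Open Scope classical_set_scope.
Local Open Scope ring_scope.

(* Vectors of R^n are columns 'cV[R]_n.  On them the library norm `|x| is the
   max-norm, so `|x| stands for ||x||_oo and the Euclidean norm is [enorm]. *)

Definition dot (R : realType) (n : nat) (u v : 'cV[R]_n) : R :=
  (u^T *m v) ord0 ord0.

Definition enorm (R : realType) (n : nat) (u : 'cV[R]_n) : R :=
  Num.sqrt (dot u u).

Definition quad (R : realType) (n : nat) (A : 'M[R]_n) (u : 'cV[R]_n) : R :=
  dot u (A *m u).

Definition opnorm (R : realType) (n : nat) (A : 'M[R]_n) : R :=
  sup [set enorm (A *m u) | u in [set u : 'cV[R]_n | enorm u = 1]].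

(* A - B positive semidefinite; only used for symmetric A and B. *)
Definition loewner_ge (R : realType) (n : nat) (A B : 'M[R]_n) : Prop :=
  forall u : 'cV[R]_n, 0 <= quad (A - B) u.

Definition grad (R : realType) (n : nat) (f : 'cV[R]_n -> R) (x : 'cV[R]_n) :
    'cV[R]_n :=
  \col_i 'D_(delta_mx i ord0) f x.

Definition hess (R : realType) (n : nat) (f : 'cV[R]_n -> R) (x : 'cV[R]_n) :
    'M[R]_n :=
  \matrix_(i, j)
    'D_(delta_mx j ord0) (fun y : 'cV[R]_n => 'D_(delta_mx i ord0) f y) x.

Definition twice_differentiable (R : realType) (n : nat) (f : 'cV[R]_n -> R)
    (x : 'cV[R]_n) : Prop :=
  (\forall y \near x, differentiable f y) /\ differentiable (grad f) x.

Definition twice_lipschitz_on (R : realType) (n : nat) (f : 'cV[R]_n -> R)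
    (U : set 'cV[R]_n) (Lg LH : R) : Prop :=
  [/\ forall x, U x -> twice_differentiable f x,
      forall x y, U x -> U y ->
        enorm (grad f x - grad f y) <= Lg * enorm (x - y) &
      forall x y, U x -> U y ->
        opnorm (hess f x - hess f y) <= LH * enorm (x - y)].

Definition barrier (R : realType) (n : nat) (f : 'cV[R]_n -> R) (mu : R)
    (x : 'cV[R]_n) : R :=
  f x - mu * \sum_i ln (x i ord0).

Definition Dx (R : realType) (n : nat) (x : 'cV[R]_n) : 'M[R]_n :=
  diag_mx x^T.

Definition Dbar (R : realType) (n : nat) (x : 'cV[R]_n) : 'M[R]_n :=
  Dx (\col_i Num.min (x i ord0) 1).

Definition Dratio (R : realType) (n : nat) (x : 'cV[R]_n) : 'M[R]_n :=
  invmx (Dx x) *m Dbar x.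

(* s is a value of sgn a, where sgn 0 may be either of -1 and 1. *)
Definition is_sgn (R : realType) (a s : R) : Prop :=
  (s = 1 \/ s = -1) /\ 0 <= s * a.

Definition ccg_kappa (R : realType) (eps M : R) : R := (M + 2 * eps) / eps.

Definition ccg_zeta (R : realType) (eps zr M : R) : R :=
  zr / (3 * ccg_kappa eps M).

Definition ccg_tau (R : realType) (eps M : R) : R :=
  Num.sqrt (ccg_kappa eps M) / (Num.sqrt (ccg_kappa eps M) + 1).

Definition ccg_T (R : realType) (eps M : R) : R :=
  4 * ccg_kappa eps M ^+ 4 / (1 - Num.sqrt (ccg_tau eps M)) ^+ 2.

(* The first z of zs with ||H z|| > M ||z||, if any, resets M. *)
Definition ccg_raise (R : realType) (n : nat) (H : 'M[R]_n) (M : R)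
    (zs : seq 'cV[R]_n) : R :=
  foldr (fun z M' => if M * enorm z < enorm (H *m z)
                     then enorm (H *m z) / enorm z else M') M zs.

Record ccg_state (R : realType) (n : nat) := CcgState {
  ccg_y : 'cV[R]_n;
  ccg_r : 'cV[R]_n;
  ccg_p : 'cV[R]_n;
  ccg_M : R }.

Record ccg_input (R : realType) (n : nat) := CcgInput {
  ccg_H : 'M[R]_n;
  ccg_g : 'cV[R]_n;
  ccg_eps : R;
  ccg_zr : R;
  ccg_cmu : R;
  ccg_M0 : R }.

Definition ccg_Hbar (R : realType) (n : nat) (I : ccg_input R n) : 'M[R]_n :=
  ccg_H I + (2 * ccg_eps I)%:M.

Definition ccg_init (R : realType) (n : nat) (I : ccg_input R n) :
    ccg_state R n :=
  CcgState 0 (ccg_g I) (- ccg_g I)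
    (ccg_raise (ccg_H I) (ccg_M0 I) [:: - ccg_g I]).

Definition ccg_a (R : realType) (n : nat) (I : ccg_input R n)
    (s : ccg_state R n) : R :=
  enorm (ccg_r s) ^+ 2 / quad (ccg_Hbar I) (ccg_p s).

Definition ccg_next_y (R : realType) (n : nat) (I : ccg_input R n)
    (s : ccg_state R n) : 'cV[R]_n :=
  ccg_y s + ccg_a I s *: ccg_p s.

Definition ccg_next (R : realType) (n : nat) (I : ccg_input R n)
    (s : ccg_state R n) : ccg_state R n :=
  let y := ccg_next_y I s in
  let r := ccg_r s + ccg_a I s *: (ccg_Hbar I *m ccg_p s) in
  let b := enorm r ^+ 2 / enorm (ccg_r s) ^+ 2 in
  let p := - r + b *: ccg_p s in
  CcgState y r p (ccg_raise (ccg_H I) (ccg_M s) [:: p; y; r]).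

Definition ccg_iter (R : realType) (n : nat) (I : ccg_input R n) (j : nat) :
    ccg_state R n :=
  iter j (ccg_next I) (ccg_init I).

Inductive d_type := NC | SOL.

Definition neg_curv (R : realType) (n : nat) (I : ccg_input R n)
    (z : 'cV[R]_n) : bool :=
  quad (ccg_Hbar I) z < ccg_eps I * enorm z ^+ 2.

Definition ccg_solved (R : realType) (n : nat) (I : ccg_input R n)
    (s : ccg_state R n) : bool :=
  (enorm (ccg_r s) <=
     ccg_zeta (ccg_eps I) (ccg_zr I) (ccg_M s) * enorm (ccg_g I))
  && (`|ccg_r s| <= ccg_cmu I).

Definition ccg_slow (R : realType) (n : nat) (I : ccg_input R n) (j : nat)
    (s : ccg_state R n) : bool :=
  Num.sqrt (ccg_T (ccg_eps I) (ccg_M s))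
    * ccg_tau (ccg_eps I) (ccg_M s) `^ (j%:R / 2) * enorm (ccg_g I)
  < enorm (ccg_r s).

(* The loop can exit at index j >= 1 with the given direction and type; the
   index i of the last test is any admissible one.  Should there be none, no
   test applies and the loop goes on. *)
Inductive ccg_exit (R : realType) (n : nat) (I : ccg_input R n) (j : nat) :
    'cV[R]_n -> d_type -> Prop :=
| ExitY :
    neg_curv I (ccg_y (ccg_iter I j)) ->
    ccg_exit I j (ccg_y (ccg_iter I j)) NC
| ExitSol :
    ~~ neg_curv I (ccg_y (ccg_iter I j)) ->
    ccg_solved I (ccg_iter I j) ->
    ccg_exit I j (ccg_y (ccg_iter I j)) SOL
| ExitP :
    ~~ neg_curv I (ccg_y (ccg_iter I j)) ->
    ~~ ccg_solved I (ccg_iter I j) ->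
    neg_curv I (ccg_p (ccg_iter I j)) ->
    ccg_exit I j (ccg_p (ccg_iter I j)) NC
| ExitSlow (i : nat) :
    ~~ neg_curv I (ccg_y (ccg_iter I j)) ->
    ~~ ccg_solved I (ccg_iter I j) ->
    ~~ neg_curv I (ccg_p (ccg_iter I j)) ->
    ccg_slow I j (ccg_iter I j) ->
    (i < j)%N ->
    neg_curv I (ccg_next_y I (ccg_iter I j) - ccg_y (ccg_iter I i)) ->
    ccg_exit I j (ccg_next_y I (ccg_iter I j) - ccg_y (ccg_iter I i)) NC.

Inductive ccg_returns (R : realType) (n : nat) (I : ccg_input R n) :
    'cV[R]_n -> d_type -> Prop :=
| ReturnsFirst :
    neg_curv I (- ccg_g I) -> ccg_returns I (- ccg_g I) NC
| ReturnsLoop (j : nat) (d : 'cV[R]_n) (ty : d_type) :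
    ~~ neg_curv I (- ccg_g I) ->
    (0 < j)%N ->
    (forall i d' ty', (0 < i < j)%N -> ~ ccg_exit I i d' ty') ->
    ccg_exit I j d ty ->
    ccg_returns I d ty.

Inductive meo_output (R : realType) (n : nat) :=
| Certificate
| Direction of R & 'cV[R]_n.
Arguments Certificate {R n}.

Definition meo_direction (R : realType) (n : nat) (H : 'M[R]_n) (eps lam : R)
    (v : 'cV[R]_n) : Prop :=
  [/\ lam <= - eps / 2, enorm v = 1 & quad H v = lam].

(* A direction is always a true one; a certificate may be false. *)
Definition meo_correct (R : realType) (n : nat) (H : 'M[R]_n) (eps : R)
    (o : meo_output R n) : Prop :=
  match o with
  | Certificate => loewner_ge H (- eps)%:M
  | Direction lam v => meo_direction H eps lam v
  end.

(* For C >= 0 the absolute value only casts the ceiling to nat. *)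
Definition n_meo (R : realType) (n : nat) (C epsH : R) : nat :=
  minn n (1 + `|Num.ceil (C * epsH `^ (- (1 / 2)))|)%N.

Definition at_most_logarithmic (R : realType) (C : R -> R -> R) : Prop :=
  (forall delta eps, 0 <= delta < 1 -> 0 < eps < 1 -> 0 <= C delta eps) /\
  exists A : R, forall delta eps, 0 < delta < 1 -> 0 < eps < 1 ->
    C delta eps <= A * (1 + ln (delta^-1) + ln (eps^-1)).

Record lbncg_params (R : realType) := LbncgParams {
  eps_g : R;
  theta : R;
  zeta_r : R;
  zeta_b : R;
  beta : R;
  eta : R;
  Mhat : option R }.

Definition eps_H (R : realType) (q : lbncg_params R) : R :=
  eps_g q `^ (1 / 2).

Definition lb_mu (R : realType) (q : lbncg_params R) : R := eps_g q / 4.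

Definition params_ok (R : realType) (q : lbncg_params R) : Prop :=
  [/\ 0 < eps_g q < 1, 0 < theta q < 1, 0 < zeta_r q < 1 & 0 < zeta_b q < 1]
  /\ (eps_g q `^ (1 / 2) <= beta q < 1 /\ 0 < eta q < 1).

Definition Mhat_ok (R : realType) (n : nat) (f : 'cV[R]_n -> R)
    (q : lbncg_params R) : Prop :=
  forall M, Mhat q = Some M ->
    0 < M /\ forall x, twice_differentiable f x -> opnorm (hess f x) <= M.

Definition first_order_violated (R : realType) (n : nat)
    (f : 'cV[R]_n -> R) (q : lbncg_params R) (x : 'cV[R]_n) : Prop :=
  (exists i, grad f x i ord0 <= - eps_g q)
  \/ eps_g q < `|Dbar x *m grad f x|.

Definition lb_phi (R : realType) (n : nat) (f : 'cV[R]_n -> R)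
    (q : lbncg_params R) : 'cV[R]_n -> R := barrier f (lb_mu q).

Definition lb_g (R : realType) (n : nat) (f : 'cV[R]_n -> R)
    (q : lbncg_params R) (x : 'cV[R]_n) : 'cV[R]_n :=
  Dbar x *m grad (lb_phi f q) x.

Definition lb_H (R : realType) (n : nat) (f : 'cV[R]_n -> R)
    (q : lbncg_params R) (x : 'cV[R]_n) : 'M[R]_n :=
  Dbar x *m hess (lb_phi f q) x *m Dbar x.

Definition scaled_hess (R : realType) (n : nat) (f : 'cV[R]_n -> R)
    (x : 'cV[R]_n) : 'M[R]_n :=
  Dbar x *m hess f x *m Dbar x.

Definition lb_ccg (R : realType) (n : nat) (f : 'cV[R]_n -> R)
    (q : lbncg_params R) (x : 'cV[R]_n) : ccg_input R n :=
  CcgInput (lb_H f q x) (lb_g f q x) (eps_H q) (zeta_r q)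
    (zeta_b q * lb_mu q) (odflt 0 (Mhat q) + lb_mu q).

(* [search_direction f q x o d]: at the iterate x, with oracle answer o (not
   looked at when CCG is the procedure called), d is a possible d^k. *)
Inductive search_direction (R : realType) (n : nat) (f : 'cV[R]_n -> R)
    (q : lbncg_params R) (x : 'cV[R]_n) :
    meo_output R n -> 'cV[R]_n -> Prop :=
| DirCcgNC (o : meo_output R n) (dh : 'cV[R]_n) (s : R) :
    first_order_violated f q x ->
    ccg_returns (lb_ccg f q x) dh NC ->
    is_sgn (dot (lb_g f q x) dh) s ->
    search_direction f q x o
      ((- s * Num.min (`|quad (lb_H f q x) dh| / enorm dh ^+ 3)
                      (beta q / `|Dratio x *m dh|)) *: dh)
| DirCcgSol (o : meo_output R n) (dh : 'cV[R]_n) :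
    first_order_violated f q x ->
    ccg_returns (lb_ccg f q x) dh SOL ->
    search_direction f q x o (Num.min 1 (beta q / `|Dratio x *m dh|) *: dh)
| DirMeo (lam : R) (v : 'cV[R]_n) (s : R) :
    ~ first_order_violated f q x ->
    meo_direction (scaled_hess f x) (eps_H q) lam v ->
    is_sgn (dot v (lb_g f q x)) s ->
    search_direction f q x (Direction lam v)
      ((- s * Num.min `|quad (lb_H f q x) v|
                      (beta q / `|Dratio x *m v|)) *: v).

Definition trial_point (R : realType) (n : nat) (q : lbncg_params R)
    (x d : 'cV[R]_n) (j : nat) : 'cV[R]_n :=
  x + theta q ^+ j *: (Dbar x *m d).

Definition accepted (R : realType) (n : nat) (f : 'cV[R]_n -> R)
    (q : lbncg_params R) (x d : 'cV[R]_n) (j : nat) : bool :=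
  lb_phi f q (trial_point q x d j)
  < lb_phi f q x - eta q / 6 * (theta q ^+ j) ^+ 3 * enorm d ^+ 3.

(* State before an iteration.  [Stuck]: an earlier CCG call or line search
   never came to an end. *)
Inductive lbncg_state (R : realType) (n : nat) :=
| Running of 'cV[R]_n
| Terminated of 'cV[R]_n
| Stuck.
Arguments Stuck {R n}.

(* [lbncg_step f q s o d s']: one iteration leads from s to s', with oracle
   answer o and direction d (each irrelevant when the iteration has none). *)
Inductive lbncg_step (R : realType) (n : nat) (f : 'cV[R]_n -> R)
    (q : lbncg_params R) : lbncg_state R n -> meo_output R n -> 'cV[R]_n ->
    lbncg_state R n -> Prop :=
| StepMove (x d : 'cV[R]_n) (o : meo_output R n) (j : nat) :
    search_direction f q x o d ->
    accepted f q x d j ->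
    (forall i, (i < j)%N -> ~~ accepted f q x d i) ->
    lbncg_step f q (Running x) o d (Running (trial_point q x d j))
| StepNoAccept (x d : 'cV[R]_n) (o : meo_output R n) :
    search_direction f q x o d ->
    (forall j, ~~ accepted f q x d j) ->
    lbncg_step f q (Running x) o d Stuck
| StepNoReturn (x d : 'cV[R]_n) (o : meo_output R n) :
    first_order_violated f q x ->
    (forall dh ty, ~ ccg_returns (lb_ccg f q x) dh ty) ->
    lbncg_step f q (Running x) o d Stuck
| StepCertified (x d : 'cV[R]_n) :
    ~ first_order_violated f q x ->
    lbncg_step f q (Running x) Certificate d (Terminated x)
| StepTerminated (x d : 'cV[R]_n) (o : meo_output R n) :
    lbncg_step f q (Terminated x) o d (Terminated x)
| StepStuck (d : 'cV[R]_n) (o : meo_output R n) :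
    lbncg_step f q Stuck o d Stuck.

(* A random run: state before iteration k, oracle answer, number of
   Hessian-vector products spent by the oracle, and direction. *)
Record lbncg_process (R : realType) (n : nat) (Omega : Type) := LbncgProcess {
  st : nat -> Omega -> lbncg_state R n;
  out : nat -> Omega -> meo_output R n;
  hv : nat -> Omega -> nat;
  dir : nat -> Omega -> 'cV[R]_n }.

Definition lbncg_run (R : realType) (n : nat) (Omega : Type)
    (f : 'cV[R]_n -> R) (q : lbncg_params R) (x0 : 'cV[R]_n)
    (r : lbncg_process R n Omega) : Prop :=
  forall w, st r 0 w = Running x0
    /\ forall k, lbncg_step f q (st r k w) (out r k w) (dir r k w)
                            (st r k.+1 w).

Definition assumption1 (R : realType) (n : nat) (Omega : Type)
    (f : 'cV[R]_n -> R) (q : lbncg_params R) (r : lbncg_process R n Omega)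
    (Lg LH : R) : Prop :=
  forall w, exists U : set 'cV[R]_n,
    [/\ open U, twice_lipschitz_on f U Lg LH &
        forall k x, st r k w = Running x ->
          U x /\
          (search_direction f q x (out r k w) (dir r k w) ->
           forall j t, 0 <= t <= 1 ->
             U (x + t *: (trial_point q x (dir r k w) j - x)))].

Definition assumption2 (R : realType) (n : nat) (f : 'cV[R]_n -> R)
    (flow : R) : Prop :=
  forall x, flow <= f x.

Definition meo_called (R : realType) (n : nat) (Omega : Type)
    (f : 'cV[R]_n -> R) (q : lbncg_params R) (r : lbncg_process R n Omega)
    (k : nat) : set Omega :=
  [set w | exists x, st r k w = Running x /\ ~ first_order_violated f q x].

Definition meo_right (R : realType) (n : nat) (Omega : Type)
    (f : 'cV[R]_n -> R) (q : lbncg_params R) (r : lbncg_process R n Omega)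
    (k : nat) : set Omega :=
  [set w | exists x, [/\ st r k w = Running x, ~ first_order_violated f q x &
                         meo_correct (scaled_hess f x) (eps_H q) (out r k w)]].

(* F k is the sigma-algebra of the history up to the oracle call of iteration
   k; of that history only the events below need to belong to it. *)
Definition history (R : realType) (n : nat) (disp : measure_display)
    (Omega : measurableType disp) (f : 'cV[R]_n -> R) (q : lbncg_params R)
    (r : lbncg_process R n Omega) (F : nat -> set (set Omega)) : Prop :=
  forall k,
    [/\ sigma_algebra setT (F k), F k `<=` measurable, F k `<=` F k.+1,
        F k (meo_called f q r k) &
        F k.+1 (meo_right f q r k)
        /\ forall m, F k.+1 [set w | hv r k w = m]].

(* Conditional probability at least 1 - delta given F k, written out as its
   integral over the events of F k. *)
Definition assumption4 (R : realType) (n : nat) (disp : measure_display)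
    (Omega : measurableType disp) (P : probability Omega R)
    (f : 'cV[R]_n -> R) (q : lbncg_params R) (r : lbncg_process R n Omega)
    (F : nat -> set (set Omega)) (delta : R) (Cmeo : R -> R -> R) : Prop :=
  at_most_logarithmic Cmeo /\
  forall k (A : set Omega), F k A -> A `<=` meo_called f q r k ->
    ((1 - delta)%:E * P A <=
     P (A `&` meo_right f q r k `&`
        [set w | (hv r k w <= n_meo n (Cmeo delta (eps_H q)) (eps_H q))%N]))%E.

Definition c_d (R : realType) (q : lbncg_params R) (LH : R) : R :=
  Num.min ((1 - zeta_b q) / 9)
    (Num.min ((3 / (2 * LH)) `^ (1 / 2))
       (1 / (2 * (LH + 9 / 2 + zeta_r q)))).

Definition c_sol (R : realType) (q : lbncg_params R) (LH : R) : R :=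
  Num.min (c_d q LH)
    (6 * (1 - beta q) ^+ 2 * theta q ^+ 2
     / ((LH + eta q) * (1 - beta q) ^+ 2 + (2 - beta q))).

Definition c_nc (R : realType) (q : lbncg_params R) (LH : R) : R :=
  Num.min 1
    (3 * (1 - beta q) ^+ 2 * theta q
     / ((LH + eta q) * (1 - beta q) ^+ 2 + (2 - beta q))).

Definition c_all (R : realType) (q : lbncg_params R) (LH : R) : R :=
  Num.min (c_sol q LH) (c_nc q LH).

Definition min_log (R : realType) (n : nat) (x : 'cV[R]_n.+1) : R :=
  \big[Num.min/ln (x ord0 ord0)]_i ln (x i ord0).

Definition omega2 (R : realType) (eta call : R) (n : nat) (xmax : R) : R :=
  Num.max (96 * Num.sqrt n%:R / (eta * call ^+ 2)) xmax.

(* With gap = f x0 - flow, xmax = ||x0||_oo and lmin = min_i log x0_i.  The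
   number rounded up is then nonnegative, so the absolute value only casts
   the ceiling to nat. *)
Definition K2bar (R : realType) (eta call gap xmax lmin : R) (n : nat)
    (epsg : R) : nat :=
  (`|Num.ceil (1536 * (gap + epsg / 4 * n%:R *
                       (ln (omega2 eta call n xmax) - lmin))
               / (eta * call ^+ 3) * epsg `^ (- (3 / 2)))| + 2)%N.

(* K n eps = \tilde O (B n eps): up to a constant factor and to a power of the
   logarithms of n and 1/eps, uniformly in n >= 1 and 0 < eps < 1. *)
Definition tildeO (R : realType) (K B : nat -> R -> R) : Prop :=
  exists (C : R) (m : nat), forall n eps, (0 < n)%N -> 0 < eps < 1 ->
    K n eps <= C * (1 + ln n%:R + ln (eps^-1)) ^+ m * B n eps.

Definition first_order_point (R : realType) (n : nat) (f : 'cV[R]_n -> R)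
    (q : lbncg_params R) (x : 'cV[R]_n) : Prop :=
  [/\ forall i, 0 < x i ord0,
      forall i, - eps_g q <= grad f x i ord0 &
      `|Dbar x *m grad f x| <= eps_g q].

Definition second_order_cond (R : realType) (n : nat) (f : 'cV[R]_n -> R)
    (q : lbncg_params R) (x : 'cV[R]_n) : Prop :=
  loewner_ge (scaled_hess f x) (- eps_H q)%:M.

(* As [Terminated] is absorbing, being [Terminated] before iteration K means
   having stopped within the iterations 0, ..., K - 1. *)
Definition stops_correctly (R : realType) (n : nat) (Omega : Type)
    (f : 'cV[R]_n -> R) (q : lbncg_params R) (r : lbncg_process R n Omega)
    (K : nat) : set Omega :=
  [set w | exists x, [/\ st r K w = Terminated x, first_order_point f q x &
                         second_order_cond f q x]].

Definition stops_incorrectly (R : realType) (n : nat) (Omega : Type)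
    (f : 'cV[R]_n -> R) (q : lbncg_params R) (r : lbncg_process R n Omega)
    (K : nat) : set Omega :=
  [set w | exists x, [/\ st r K w = Terminated x, first_order_point f q x &
                         ~ second_order_cond f q x]].

(* Main.v *)
(* Write sigma = c_all eps_H / 4.  A Taylor expansion of f along the trial
   segment, together with -ln(1+t) <= -t + t^2/2 + |t|^3/(3(1-beta)) for the
   barrier, bounds phi_mu by its scaled quadratic model plus a cubic term, so
   the line search stops and every accepted step has alpha ||d|| >= sigma,
   except for a full Newton step shorter than sigma.  After such a short step
   the residual test of CCG and the Lipschitz Hessian make the first-order
   conditions hold, hence two short steps never follow each other.  With B
   steps that are not short, of total length T, the barrier decreases by more
   than eta sigma^2 T / 6 while the iterates move by at most 2 T + sigma; since
   ln t <= ln w + t/w - 1 with w = omega_2, the logarithms can absorb only half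
   of that decrease, which bounds B and so the number K_2 of iterations.  CCG
   itself stops because the residuals of conjugate gradients are pairwise
   orthogonal as long as no test applies.

   Thus every run is terminated before iteration K_2 by a certificate at a
   first-order point, and it is incorrect exactly when that certificate is
   false.  Each oracle call is right with conditional probability at least
   1 - delta, which gives (1 - delta)^K_2 by induction on the filtration. *)

Require Import Defs.
From mathcomp Require Import all_boot all_order all_algebra.
From mathcomp Require Import all_classical all_reals all_analysis.
From mathcomp Require Import ring lra.

Import Order.TTheory GRing.Theory Num.Theory.
Import numFieldNormedType.Exports.
Local Open Scope classical_set_scope.
Local Open Scope ring_scope.

Set Implicit Arguments.
Unset Strict Implicit.
Unset Printing Implicit Defensive.

(** * Euclidean geometry *)

(** The numerical constants belong together. Put mu = eps_H^2 / 4 and sigma = c_all eps_H / 4, and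
    let Q be f(x0) - f_low plus mu n times the logarithmic gap. The 96 in omega_2 makes mu sqrt(n) /
    omega_2 at most eta sigma^2 / 24, so a displacement of 2 T + sigma gives back eta sigma^2 T /
    12, up to a multiple of sigma^3. What remains yields B < 12 Q / (eta sigma^3) + 1/2; short steps
    can double the count, and 24 times 4^3 is 1536. The hypotheses on randomness concern only events
    of the filtration: neither states nor directions are assumed measurable. The stopping events are
    therefore identified pointwise with the event that no oracle call has failed, or its complement,
    and everything about the iterates is proved for a fixed outcome. [hess] is a matrix of iterated
    directional derivatives, while the orthogonality relations of CCG rest on a symmetric matrix;
    symmetry is derived from the Lipschitz bound on the Hessian. *)

Lemma dotE (R : realType) (n : nat) (u v : 'cV[R]_n) :
  dot u v = \sum_i u i ord0 * v i ord0.
Proof. by rewrite /dot mxE; apply: eq_bigr => i _; rewrite mxE. Qed.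

Lemma dotC (R : realType) (n : nat) (u v : 'cV[R]_n) : dot u v = dot v u.
Proof. by rewrite !dotE; apply: eq_bigr => i _; rewrite mulrC. Qed.

Lemma dotDr (R : realType) (n : nat) (u v w : 'cV[R]_n) :
  dot u (v + w) = dot u v + dot u w.
Proof. by rewrite /dot mulmxDr mxE. Qed.

Lemma dotDl (R : realType) (n : nat) (u v w : 'cV[R]_n) :
  dot (v + w) u = dot v u + dot w u.
Proof. by rewrite !(dotC _ u) dotDr. Qed.

Lemma dotZr (R : realType) (n : nat) a (u v : 'cV[R]_n) :
  dot u (a *: v) = a * dot u v.
Proof. by rewrite /dot -scalemxAr mxE. Qed.

Lemma dotZl (R : realType) (n : nat) a (u v : 'cV[R]_n) :
  dot (a *: u) v = a * dot u v.
Proof. by rewrite dotC dotZr dotC. Qed.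

Lemma dotNr (R : realType) (n : nat) (u v : 'cV[R]_n) : dot u (- v) = - dot u v.
Proof. by rewrite -scaleN1r dotZr mulN1r. Qed.

Lemma dotNl (R : realType) (n : nat) (u v : 'cV[R]_n) : dot (- u) v = - dot u v.
Proof. by rewrite dotC dotNr dotC. Qed.

Lemma dotBr (R : realType) (n : nat) (u v w : 'cV[R]_n) :
  dot u (v - w) = dot u v - dot u w.
Proof. by rewrite dotDr dotNr. Qed.

Lemma dot0r (R : realType) (n : nat) (u : 'cV[R]_n) : dot u 0 = 0.
Proof. by rewrite -(scale0r 0) dotZr mul0r. Qed.

Lemma dot0l (R : realType) (n : nat) (u : 'cV[R]_n) : dot 0 u = 0.
Proof. by rewrite dotC dot0r. Qed.

Lemma dot_ge0 (R : realType) (n : nat) (u : 'cV[R]_n) : 0 <= dot u u.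
Proof. by rewrite dotE; apply: sumr_ge0 => i _; rewrite -expr2 sqr_ge0. Qed.

Lemma dot_eq0 (R : realType) (n : nat) (u : 'cV[R]_n) : (dot u u == 0) = (u == 0).
Proof.
apply/eqP/eqP => [|->]; last by rewrite dot0r.
rewrite dotE => /eqP.
rewrite psumr_eq0 => [/allP h|i _]; last by rewrite -expr2 sqr_ge0.
apply/matrixP => i j; rewrite mxE (ord1 j).
by have := h i (mem_index_enum _); rewrite /= -expr2 sqrf_eq0 => /eqP.
Qed.

Lemma enorm_ge0 (R : realType) (n : nat) (u : 'cV[R]_n) : 0 <= enorm u.
Proof. exact: sqrtr_ge0. Qed.

Lemma enorm_sqr (R : realType) (n : nat) (u : 'cV[R]_n) : enorm u ^+ 2 = dot u u.
Proof. by rewrite sqr_sqrtr // dot_ge0. Qed.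

Lemma enorm_eq0 (R : realType) (n : nat) (u : 'cV[R]_n) : (enorm u == 0) = (u == 0).
Proof. by rewrite -dot_eq0 -enorm_sqr sqrf_eq0. Qed.

Lemma enorm_gt0 (R : realType) (n : nat) (u : 'cV[R]_n) : (0 < enorm u) = (u != 0).
Proof. by rewrite lt_neqAle enorm_ge0 andbT eq_sym enorm_eq0. Qed.

Lemma enormZ (R : realType) (n : nat) a (u : 'cV[R]_n) : enorm (a *: u) = `|a| * enorm u.
Proof.
by rewrite /enorm dotZl dotZr mulrA -expr2 sqrtrM ?sqr_ge0 // sqrtr_sqr.
Qed.

Lemma dot_le_enorm (R : realType) (n : nat) (u v : 'cV[R]_n) :
  dot u v <= enorm u * enorm v.
Proof.
have [->|u0] := eqVneq u 0; first by rewrite dot0l mulr_ge0 ?enorm_ge0.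
have [->|v0] := eqVneq v 0; first by rewrite dot0r mulr_ge0 ?enorm_ge0.
have a0 : 0 < enorm u by rewrite enorm_gt0.
have b0 : 0 < enorm v by rewrite enorm_gt0.
have := dot_ge0 (enorm v *: u - enorm u *: v).
rewrite dotBr !dotDl !dotNl !dotZl !dotZr -!enorm_sqr (dotC v u).
set a := enorm u in a0 *; set b := enorm v in b0 *; set c := dot u v => h.
have : 0 <= (a * b) * (a * b - c) by nra.
by rewrite pmulr_rge0 ?mulr_gt0 // subr_ge0.
Qed.

Lemma norm_dot_le (R : realType) (n : nat) (u v : 'cV[R]_n) :
  `|dot u v| <= enorm u * enorm v.
Proof.
rewrite ler_norml dot_le_enorm andbT lerNl -dotNl.
apply: le_trans (dot_le_enorm _ _) _.
by rewrite -scaleN1r enormZ normrN1 mul1r.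
Qed.

Lemma sqr_enormE (R : realType) (n : nat) (u : 'cV[R]_n) :
  enorm u ^+ 2 = \sum_i u i ord0 ^+ 2.
Proof. by rewrite enorm_sqr dotE; apply: eq_bigr => i _; rewrite expr2. Qed.

Lemma coord_le_enorm (R : realType) (n : nat) (u : 'cV[R]_n) i :
  `|u i ord0| <= enorm u.
Proof.
rewrite -(ler_pXn2r (n := 2)) ?nnegrE ?enorm_ge0 // sqr_enormE real_normK ?num_real //.
by rewrite (bigD1 i) //= lerDl sumr_ge0 // => j _; rewrite sqr_ge0.
Qed.

Lemma coord_le_norm (R : realType) (n : nat) (u : 'cV[R]_n) i :
  `|u i ord0| <= `|u|.
Proof.
rewrite [leRHS]/Num.Def.normr/= mx_normrE.
by rewrite (le_trans _ (le_bigmax _ _ (i, ord0))).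
Qed.

Lemma norm_leP (R : realType) (n : nat) (u : 'cV[R]_n) (c : R) : 0 <= c ->
  (forall i, `|u i ord0| <= c) -> `|u| <= c.
Proof.
move=> c0 h; rewrite /Num.Def.normr/= mx_normrE; apply: bigmax_le => // -[i j] _ /=.
by rewrite (ord1 j).
Qed.

Lemma norm_le_enorm (R : realType) (n : nat) (u : 'cV[R]_n) : `|u| <= enorm u.
Proof. by apply: norm_leP (enorm_ge0 _) _ => i; apply: coord_le_enorm. Qed.

(** [opnorm] is a supremum, which is meaningful only for a set bounded above; any finite constant
    serves, and Cauchy-Schwarz row by row supplies one. *)
Lemma enorm_mulmx_bound (R : realType) (n : nat) (A : 'M[R]_n) :
  exists C : R, forall u, enorm (A *m u) <= C * enorm u.
Proof.
exists (\sum_i enorm (row i A)^T) => u.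
have S0 : 0 <= \sum_i enorm (row i A)^T by apply: sumr_ge0 => i _; exact: enorm_ge0.
have sq (I : finType) (a : I -> R) : (forall i, 0 <= a i) ->
    \sum_i a i ^+ 2 <= (\sum_i a i) ^+ 2.
  move=> a0; rewrite expr2 mulr_suml; apply: ler_sum => i _.
  rewrite expr2 ler_wpM2l // (bigD1 i) //= lerDl sumr_ge0 //.
rewrite -(ler_pXn2r (n := 2)) ?nnegrE ?enorm_ge0 ?mulr_ge0 ?enorm_ge0 //.
rewrite exprMn sqr_enormE.
apply: (@le_trans _ _ (\sum_i enorm (row i A)^T ^+ 2 * enorm u ^+ 2)); last first.
  rewrite -mulr_suml ler_wpM2r ?sqr_ge0 //; apply: sq => i; exact: enorm_ge0.
apply: ler_sum => i _; rewrite -exprMn.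
have -> : (A *m u) i ord0 = dot (row i A)^T u.
  by rewrite dotE mxE; apply: eq_bigr => j _; rewrite !mxE.
rewrite -real_normK ?num_real // ler_pXn2r ?nnegrE ?mulr_ge0 ?enorm_ge0 //.
exact: norm_dot_le.
Qed.

Lemma enorm_mulmx (R : realType) (n : nat) (A : 'M[R]_n) u :
  enorm (A *m u) <= opnorm A * enorm u.
Proof.
have [->|u0] := eqVneq u 0.
  by rewrite mulmx0 /enorm dot0r sqrtr0 mulr0.
have e0 : 0 < enorm u by rewrite enorm_gt0.
have [C hC] := enorm_mulmx_bound A.
set v := (enorm u)^-1 *: u.
have v1 : enorm v = 1 by rewrite enormZ gtr0_norm ?invr_gt0 // mulVf ?gt_eqF.
have -> : enorm (A *m u) = enorm (A *m v) * enorm u.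
  rewrite -scalemxAr enormZ gtr0_norm ?invr_gt0 // mulrAC mulVf ?mul1r // gt_eqF //.
apply: ler_wpM2r (ltW e0) _ _ _; apply: ub_le_sup; last by exists v.
by exists C => _ [w /= w1 <-]; rewrite -[C]mulr1 -w1; apply: hC.
Qed.

Lemma norm_dot_mulmx (R : realType) (n : nat) (A : 'M[R]_n) u v :
  `|dot u (A *m v)| <= opnorm A * enorm u * enorm v.
Proof.
apply: le_trans (norm_dot_le _ _) _.
by rewrite mulrAC mulrC ler_wpM2r ?enorm_ge0 // enorm_mulmx.
Qed.

Lemma quadZ (R : realType) (n : nat) (A : 'M[R]_n) a u :
  quad A (a *: u) = a ^+ 2 * quad A u.
Proof. by rewrite /quad -scalemxAr dotZl dotZr mulrA expr2. Qed.

Lemma quadD (R : realType) (n : nat) (A B : 'M[R]_n) u :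
  quad (A + B) u = quad A u + quad B u.
Proof. by rewrite /quad mulmxDl dotDr. Qed.

Lemma quad_scalar (R : realType) (n : nat) a (u : 'cV[R]_n) :
  quad a%:M u = a * enorm u ^+ 2.
Proof. by rewrite /quad mul_scalar_mx dotZr enorm_sqr. Qed.

Lemma dot_mulmxr (R : realType) (n : nat) (A : 'M[R]_n) u v :
  dot u (A *m v) = dot (A^T *m u) v.
Proof. by rewrite /dot trmx_mul trmxK mulmxA. Qed.

(** * Calculus along segments *)

Lemma is_derive_line (R : realType) (n : nat) (W : normedModType R)
    (F : 'cV[R]_n -> W) (x s : 'cV[R]_n) (t : R) :
  derivable F (x + t *: s) s ->
  is_derive t 1 (fun t : R => F (x + t *: s)) ('D_s F (x + t *: s)).
Proof.
move=> dF.
have e : (fun h : R => h^-1 *: (F (x + (h *: (1 : R) + t) *: s) - F (x + t *: s)))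
       = (fun h : R => h^-1 *: (F (h *: s + (x + t *: s)) - F (x + t *: s))).
  apply/funext => h; congr (_ *: (F _ - _)).
  by rewrite addrCA -scalerDl; congr (_ + _ *: _); rewrite /GRing.scale /= mulr1.
apply: DeriveDef; first by rewrite /derivable e.
by rewrite /derive e.
Qed.

Lemma derive_dot_grad (R : realType) (n : nat) (f : 'cV[R]_n -> R) x v :
  differentiable f x -> 'D_v f x = dot (grad f x) v.
Proof.
move=> df; rewrite deriveE //.
have {1}-> : v = \sum_i v i ord0 *: delta_mx i ord0.
  by rewrite {1}(matrix_sum_delta v); apply: eq_bigr => i _; rewrite big_ord1.
rewrite linear_sum dotE; apply: eq_bigr => i _.
by rewrite linearZ mxE /= deriveE // mulrC.
Qed.

(** Differentiability of the gradient makes each partial derivative differentiable, so that the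
    entrywise definition of [hess] represents the derivative in every direction. *)
Lemma derive_grad (R : realType) (n : nat) (f : 'cV[R]_n -> R) x v :
  differentiable (grad f) x -> 'D_v (grad f) x = hess f x *m v.
Proof.
move=> df; rewrite derive_mx; last exact: diff_derivable.
apply/matrixP => i j; rewrite !mxE (ord1 j).
have e : (fun y => grad f y i ord0) = (fun y => 'D_(delta_mx i ord0) f y).
  by apply/funext => y; rewrite mxE.
have dg : differentiable (fun y => 'D_(delta_mx i ord0) f y) x.
  rewrite -e; apply: (differentiable_comp (f := grad f)
    (g := fun M : 'cV[R]_n => M i ord0)) => //.
  exact: differentiable_coord.
rewrite e derive_dot_grad // dotE; apply: eq_bigr => k _.
by rewrite !mxE.
Qed.

Lemma mean_value (R : realType) (h h' : R -> R) (b : R) : 0 <= b ->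
  (forall t, 0 <= t <= b -> is_derive t 1 h (h' t)) ->
  exists2 c, 0 <= c <= b & h b - h 0 = h' c * b.
Proof.
move=> b0 dh.
have [|||c cb e] := @MVT_segment _ h h' 0 b => //.
- by move=> t; rewrite in_itv /= => /andP[t0 tb]; apply: dh; rewrite !ltW.
- apply: derivable_within_continuous => t; rewrite in_itv /= => tb.
  by have [] := dh _ tb.
by exists c; [rewrite in_itv /= in cb | rewrite subr0 in e].
Qed.

Lemma le_of_derive (R : realType) (h g h' g' : R -> R) (b : R) : 0 <= b ->
  (forall t, 0 <= t <= b -> is_derive t 1 h (h' t)) ->
  (forall t, 0 <= t <= b -> is_derive t 1 g (g' t)) ->
  (forall t, 0 <= t <= b -> h' t <= g' t) ->
  h b - h 0 <= g b - g 0.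
Proof.
move=> b0 dh dg le.
have d t : 0 <= t <= b -> is_derive t 1 (g \- h) (g' t - h' t).
  by move=> tb; apply: is_deriveB; [exact: dg|exact: dh].
have [c cb e] := mean_value b0 d.
suff : 0 <= (g \- h) b - (g \- h) 0 by rewrite /=; lra.
by rewrite e mulr_ge0 ?subr_ge0 ?le.
Qed.

Lemma is_derive_quad (R : realType) (a b : R) (t : R) :
  is_derive t 1 (fun t : R => a * t + b * t ^+ 2 / 2) (a + b * t).
Proof.
apply: is_derive_eq; rewrite /GRing.scale /=; lra.
Qed.

Lemma is_derive_cubic (R : realType) (a b c : R) (t : R) :
  is_derive t 1 (fun t : R => a * t + b * t ^+ 2 / 2 + c * t ^+ 3 / 6)
    (a + b * t + c * t ^+ 2 / 2).
Proof.
apply: is_derive_eq; rewrite /GRing.scale /=; lra.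
Qed.

(** The second derivative is only known to grow at most linearly, so there is no further derivative
    to expand with; comparison with the derivative of an explicit polynomial takes the place of an
    integral remainder. *)
Lemma taylor1_le (R : realType) (h1 h2 : R -> R) (c b : R) : 0 <= b ->
  (forall t, 0 <= t <= b -> is_derive t 1 h1 (h2 t)) ->
  (forall t, 0 <= t <= b -> h2 t <= h2 0 + c * t) ->
  h1 b <= h1 0 + h2 0 * b + c * b ^+ 2 / 2.
Proof.
move=> b0 d1 le.
have := le_of_derive b0 d1 (fun t _ => is_derive_quad (h2 0) c t) le.
rewrite expr0n /=; lra.
Qed.

Lemma taylor2_le (R : realType) (h0 h1 h2 : R -> R) (c b : R) : 0 <= b ->
  (forall t, 0 <= t <= b -> is_derive t 1 h0 (h1 t)) ->
  (forall t, 0 <= t <= b -> is_derive t 1 h1 (h2 t)) ->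
  (forall t, 0 <= t <= b -> h2 t <= h2 0 + c * t) ->
  h0 b <= h0 0 + h1 0 * b + h2 0 * b ^+ 2 / 2 + c * b ^+ 3 / 6.
Proof.
move=> b0 d0 d1 le.
have le1 t : 0 <= t <= b -> h1 t <= h1 0 + h2 0 * t + c * t ^+ 2 / 2.
  move=> /andP[t0 tb]; apply: taylor1_le => // u /andP[u0 ut]; [apply: d1|apply: le];
    by rewrite u0 (le_trans ut).
have := le_of_derive b0 d0 (fun t _ => is_derive_cubic (h1 0) (h2 0) c t) le1.
rewrite !expr0n /=; lra.
Qed.

Lemma enormD_le (R : realType) (n : nat) (u v : 'cV[R]_n) :
  enorm (u + v) <= enorm u + enorm v.
Proof.
rewrite -(ler_pXn2r (n := 2)) ?nnegrE ?addr_ge0 ?enorm_ge0 //.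
rewrite sqrrD !enorm_sqr dotDl !dotDr (dotC v u).
have := dot_le_enorm u v; lra.
Qed.

Lemma enorm_delta (R : realType) (n : nat) (i : 'I_n) :
  enorm (delta_mx i ord0 : 'cV[R]_n) = 1.
Proof.
rewrite /enorm dotE (bigD1 i) //= big1 => [|j ji].
  by rewrite !mxE !eqxx mulr1 addr0 sqrtr1.
by rewrite !mxE (negPf ji) mul0r.
Qed.

Lemma dot_delta (R : realType) (n : nat) (i : 'I_n) (u : 'cV[R]_n) :
  dot (delta_mx i ord0) u = u i ord0.
Proof.
rewrite dotE (bigD1 i) //= big1 => [|j ji].
  by rewrite !mxE !eqxx mul1r addr0.
by rewrite !mxE (negPf ji) mul0r.
Qed.

Lemma mulmx_delta (R : realType) (n : nat) (A : 'M[R]_n) (i j : 'I_n) :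
  A i j = dot (delta_mx i ord0) (A *m delta_mx j ord0).
Proof. by rewrite dot_delta -colE mxE. Qed.

Lemma mxE_sub (R : realType) (m n : nat) (A B : 'M[R]_(m, n)) i j :
  (A - B) i j = A i j - B i j.
Proof. by rewrite !mxE. Qed.

Opaque enorm dot opnorm.

(** * Expansions along segments and symmetry of the Hessian *)

Section TaylorOnSegments.
Variables (R : realType) (n : nat) (f : 'cV[R]_n -> R) (U : set 'cV[R]_n).
Variables (Lg LH : R).
Hypothesis LH0 : 0 < LH.
Hypothesis fU : twice_lipschitz_on f U Lg LH.

Lemma is_derive_segment (x s : 'cV[R]_n) (t : R) : U (x + t *: s) ->
  is_derive t 1 (fun t : R => f (x + t *: s)) (dot (grad f (x + t *: s)) s).
Proof.
have [d _ _] := fU => /d [/nbhs_singleton df _].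
rewrite -derive_dot_grad //; apply: (is_derive_line (F := f)); exact: diff_derivable.
Qed.

Lemma is_derive_grad_segment (x s u : 'cV[R]_n) (t : R) : U (x + t *: s) ->
  is_derive t 1 (fun t : R => dot u (grad f (x + t *: s)))
    (dot u (hess f (x + t *: s) *m s)).
Proof.
have [d _ _] := fU => /d [_ dg].
have lin : is_derive t 1 (fun t => grad f (x + t *: s)) (hess f (x + t *: s) *m s).
  by rewrite -(derive_grad _ dg); apply: (is_derive_line (F := grad f)); exact: diff_derivable.
have dc (i : 'I_n) : is_derive t 1 (fun t => u i ord0 * grad f (x + t *: s) i ord0)
                       (u i ord0 * (hess f (x + t *: s) *m s) i ord0).
  have [dm e] := lin.
  have := (derivable_mxP _ _ _).1 dm i ord0 => dmi.
  have di : is_derive t 1 (fun t => grad f (x + t *: s) i ord0)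
              ((hess f (x + t *: s) *m s) i ord0).
    by apply: DeriveDef => //; rewrite -e derive_mx // mxE.
  exact: is_deriveZ.
rewrite dotE.
have -> : (fun t => dot u (grad f (x + t *: s)))
        = \sum_i (fun t => u i ord0 * grad f (x + t *: s) i ord0).
  by apply/funext => y; rewrite dotE fct_sumE.
exact: is_derive_sum.
Qed.

Lemma hess_segment_le (x s u v : 'cV[R]_n) (t : R) : 0 <= t -> U x -> U (x + t *: s) ->
  dot u (hess f (x + t *: s) *m v)
    <= dot u (hess f x *m v) + LH * (enorm s * enorm u * enorm v) * t.
Proof.
move=> t0 Ux Uxt; rewrite -lerBlDl -dotBr -mulmxBl.
apply: le_trans (ler_norm _) _; apply: le_trans (norm_dot_mulmx _ _ _) _.
have [_ _ /(_ _ _ Uxt Ux)] := fU.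
have -> : x + t *: s - x = t *: s by rewrite addrAC subrr add0r.
rewrite enormZ ger0_norm // => h.
have uv : 0 <= enorm u * enorm v by rewrite mulr_ge0 ?enorm_ge0.
have -> : LH * (enorm s * enorm u * enorm v) * t = LH * (t * enorm s) * (enorm u * enorm v).
  by ring.
by rewrite -mulrA; apply: ler_wpM2r.
Qed.

Lemma taylor2_segment (x s : 'cV[R]_n) : (forall t : R, 0 <= t <= 1 -> U (x + t *: s)) ->
  f (x + s) <= f x + dot (grad f x) s + quad (hess f x) s / 2
               + LH / 6 * enorm s ^+ 3.
Proof.
move=> seg.
have Ux : U x by have := seg 0; rewrite scale0r addr0 lexx ler01; apply.
have d0 (t : R) (ht : 0 <= t <= 1) := is_derive_segment (seg t ht).
have d1 (t : R) (ht : 0 <= t <= 1) := is_derive_grad_segment s (seg t ht).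
have d0' (t : R) (ht : 0 <= t <= 1) : is_derive t 1 (fun t : R => f (x + t *: s))
    (dot s (grad f (x + t *: s))) by rewrite dotC; apply: d0.
have le (t : R) : 0 <= t <= 1 -> dot s (hess f (x + t *: s) *m s) <=
    dot s (hess f (x + 0 *: s) *m s) + LH * enorm s ^+ 3 * t.
  move=> ht; rewrite scale0r addr0.
  have /andP[t0 _] := ht.
  have -> : enorm s ^+ 3 = enorm s * enorm s * enorm s.
    by rewrite !exprS expr0 mulr1 mulrA.
  exact: (hess_segment_le s s t0 Ux (seg t ht)).
have := taylor2_le (@ler01 R) d0' d1 le.
rewrite scale1r scale0r addr0 dotC /quad !expr1n !mulr1.
by rewrite [LH * _ / 6]mulrAC.
Qed.

Lemma taylor1_segment (x s : 'cV[R]_n) i : (forall t : R, 0 <= t <= 1 -> U (x + t *: s)) ->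
  `|(grad f (x + s) - grad f x - hess f x *m s) i ord0| <= LH / 2 * enorm s ^+ 2.
Proof.
move=> seg.
have Ux : U x by have := seg 0; rewrite scale0r addr0 lexx ler01; apply.
(* Testing against a unit vector reduces the vector remainder to a scalar function of t; the choices
   e_i and -e_i then bound the absolute value of a coordinate. *)
have main u : enorm u = 1 ->
    dot u (grad f (x + s) - grad f x - hess f x *m s) <= LH / 2 * enorm s ^+ 2.
  move=> u1.
  have d1 (t : R) (ht : 0 <= t <= 1) := is_derive_grad_segment u (seg t ht).
  have le (t : R) : 0 <= t <= 1 -> dot u (hess f (x + t *: s) *m s) <=
      dot u (hess f (x + 0 *: s) *m s) + LH * enorm s ^+ 2 * t.
    move=> ht; rewrite scale0r addr0.
    have /andP[t0 _] := ht; have := hess_segment_le u s t0 Ux (seg t ht).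
    by rewrite u1 mulr1 -expr2.
  have := taylor1_le (@ler01 R) d1 le.
  rewrite scale1r scale0r addr0 expr1n !mulr1 [LH * _ / 2]mulrAC !dotBr.
  by rewrite -lerBlDl opprD addrA.
rewrite ler_norml -!dot_delta main ?enorm_delta // andbT lerNl -dotNl main //.
by rewrite -scaleN1r enormZ enorm_delta normrN1 mulr1.
Qed.

(** The mean value theorem is used twice: along e_i for the increment of f in the direction e_j,
    then along e_j for the i-th partial derivative. *)
Lemma second_difference (x : 'cV[R]_n) i j (h : R) : 0 <= h ->
  (forall a b : R, 0 <= a <= h -> 0 <= b <= h ->
     U (x + a *: delta_mx i ord0 + b *: delta_mx j ord0)) ->
  exists a b : R, [/\ 0 <= a <= h, 0 <= b <= h &
    f (x + h *: delta_mx i ord0 + h *: delta_mx j ord0)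
      - f (x + h *: delta_mx i ord0) - f (x + h *: delta_mx j ord0) + f x
    = hess f (x + a *: delta_mx i ord0 + b *: delta_mx j ord0) i j * h ^+ 2].
Proof.
set ei := delta_mx i ord0; set ej := delta_mx j ord0 => h0 box.
have hh : 0 <= h <= h by rewrite h0 lexx.
have h00 : 0 <= (0 : R) <= h by rewrite h0 lexx.
have box' a b : 0 <= a <= h -> 0 <= b <= h -> U (x + b *: ej + a *: ei).
  by move=> ha hb; rewrite addrAC; exact: box.
have box0 a : 0 <= a <= h -> U (x + a *: ei).
  by move=> ha; have := box _ _ ha h00; rewrite scale0r addr0.
have du a (ha : 0 <= a <= h) := is_derive_segment (box' _ _ ha hh).
have dv a (ha : 0 <= a <= h) := is_derive_segment (box0 _ ha).
have [a ha ea] := mean_value h0 (fun a ha => is_deriveB (du a ha) (dv a ha)).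
have {}ea : (f (x + h *: ej + h *: ei) - f (x + h *: ei))
    - (f (x + h *: ej + 0 *: ei) - f (x + 0 *: ei))
    = (dot (grad f (x + h *: ej + a *: ei)) ei - dot (grad f (x + a *: ei)) ei) * h := ea.
have dw b (hb : 0 <= b <= h) := is_derive_grad_segment ei (box _ _ ha hb).
have [b hb eb] := mean_value h0 dw.
exists a, b; split=> //.
move: ea eb; rewrite /= !scale0r !addr0 -mulmx_delta.
rewrite (addrAC x (h *: ej) (h *: ei)) !(dotC _ ei) -(addrAC x (a *: ei)) => ea eb.
have -> : hess f (x + a *: ei + b *: ej) i j * h ^+ 2
  = hess f (x + a *: ei + b *: ej) i j * h * h by ring.
rewrite -eb -ea.
move: (f _) (f _) (f _) (f _) => F1 F2 F3 F4.
by ring.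
Qed.

(* The second difference of f in the directions i and j is symmetric in them,
   and it is a value of either mixed derivative at a nearby point. *)
Lemma hess_sym (x : 'cV[R]_n) : open U -> U x -> (hess f x)^T = hess f x.
Proof.
move=> oU Ux.
have [e /= e0 Ue] : exists2 e : R, 0 < e & forall y, `|y - x| < e -> U y.
  have /nbhs_ballP[e e0 he] := open_nbhs_nbhs (conj oU Ux).
  by exists e => // y hy; apply: he; rewrite -ball_normE /= distrC.
have close i j (h : R) : 0 <= h -> h < e / 2 ->
    `|f (x + h *: delta_mx i ord0 + h *: delta_mx j ord0)
      - f (x + h *: delta_mx i ord0) - f (x + h *: delta_mx j ord0) + f x
      - hess f x i j * h ^+ 2| <= LH * (2 * h) * h ^+ 2.
  move=> h0 he.
  have dist (a b : R) : 0 <= a <= h -> 0 <= b <= h ->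
      enorm (x + a *: delta_mx i ord0 + b *: delta_mx j ord0 - x) <= 2 * h.
    move=> /andP[a0 ah] /andP[b0 bh].
    have -> : x + a *: delta_mx i ord0 + b *: delta_mx j ord0 - x
            = a *: delta_mx i ord0 + b *: delta_mx j ord0.
      by rewrite addrAC (addrAC x) subrr add0r.
    apply: le_trans (enormD_le _ _) _.
    by rewrite !enormZ !enorm_delta !ger0_norm // !mulr1; lra.
  have box (a b : R) : 0 <= a <= h -> 0 <= b <= h ->
      U (x + a *: delta_mx i ord0 + b *: delta_mx j ord0).
    move=> ha hb; apply: Ue; apply: le_lt_trans (norm_le_enorm _) _.
    by apply: le_lt_trans (dist _ _ ha hb) _; lra.
  have [a [b [ha hb ->]]] := second_difference h0 box.
  rewrite -mulrBl normrM [`|h ^+ 2|]ger0_norm ?sqr_ge0 // ler_wpM2r ?sqr_ge0 //.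
  set y := x + _ + _.
  have [_ _ /(_ y x (box _ _ ha hb) Ux) le] := fU.
  rewrite -mxE_sub mulmx_delta; apply: le_trans (norm_dot_mulmx _ _ _) _.
  rewrite !enorm_delta !mulr1; apply: le_trans le _; apply: ler_wpM2l (ltW LH0) _ _ _.
  exact: (dist a b ha hb).
apply/matrixP => i j; rewrite mxE; apply/eqP; rewrite -subr_eq0 -normr_le0.
apply/ler_addgt0Pl => d d0; rewrite addr0.
(* e / 3 keeps the box, which lies within distance 2 m of x, inside the ball contained in U; d / (4
   LH) makes each of the two errors 2 LH m at most d / 2. *)
set m := Num.min (e / 3) (d / (4 * LH)).
have m0 : 0 < m by rewrite lt_min !divr_gt0 // mulr_gt0.
have me : m < e / 2.
  by apply: (@le_lt_trans _ _ (e / 3)); [rewrite ge_min lexx | lra].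
have md : LH * (2 * m) <= d / 2.
  have : m <= d / (4 * LH) by rewrite ge_min lexx orbT.
  by rewrite ler_pdivlMr ?mulr_gt0 //; lra.
have m2 : 0 < m ^+ 2 by rewrite exprn_gt0.
have hij := close i j m (ltW m0) me.
have hji := close j i m (ltW m0) me.
rewrite (addrAC x (m *: delta_mx j ord0)) in hji.
rewrite -(ler_pM2r m2) -[X in _ * X <= _](ger0_norm (ltW m2)) -normrM.
move: hij hji.
set F := f _ - _ - _ + _; set G := f _ - _ - _ + _.
have -> : G = F.
  by rewrite /G /F; move: (f _) (f _) (f _) (f _) => F1 F2 F3 F4; ring.
move: (hess f x i j) (hess f x j i) F => a b F hij hji.
have -> : (b - a) * m ^+ 2 = (F - a * m ^+ 2) - (F - b * m ^+ 2) by ring.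
apply: le_trans (ler_normB _ _) _; apply: le_trans (lerD hij hji) _.
by rewrite -mulrDl ler_wpM2r ?(ltW m2) //; lra.
Qed.

End TaylorOnSegments.

(** * The logarithmic barrier *)

Lemma is_derive_coord (R : realType) (n : nat) (F : R -> R) (x v : 'cV[R]_n)
    (i : 'I_n) (d : R) :
  is_derive (x i ord0) 1 F d ->
  is_derive x v (fun y : 'cV[R]_n => F (y i ord0)) (d * v i ord0).
Proof.
move=> dF.
have dG : is_derive (0 : R) 1 (fun h : R => F (x i ord0 + h * v i ord0)) (d * v i ord0).
  have dF' : is_derive (x i ord0 + 0 * v i ord0) 1 F d by rewrite mul0r addr0.
  apply: (is_derive1_comp (f := F) (g := fun h : R => x i ord0 + h * v i ord0)).
  apply: is_derive_eq; rewrite /GRing.scale /=; ring.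
have e : (fun h : R => h^-1 *: (F ((h *: v + x) i ord0) - F (x i ord0)))
  = (fun h : R => h^-1 *: (F (x i ord0 + (h *: (1 : R) + 0) * v i ord0)
                          - F (x i ord0 + 0 * v i ord0))).
  apply/funext => h; rewrite mul0r !addr0 !mxE addrC.
  by rewrite /GRing.scale /= mulr1.
have [dv de] := dG.
by apply: DeriveDef; [rewrite /derivable e | rewrite /derive e].
Qed.

Lemma near_pos (R : realType) (n : nat) (x : 'cV[R]_n) :
  (forall i, 0 < x i ord0) -> nbhs x [set y | forall i, 0 < y i ord0].
Proof.
move=> x0.
apply: (@filter_forall _ 'I_n (fun i => [set y : 'cV[R]_n | 0 < y i ord0])
          (nbhs x) (nbhs_filter x)) => i.
have /(_ [set y | 0 < y]) := @coord_continuous R n 1 i ord0 x.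
by apply; exact: lt_nbhsr.
Qed.

Lemma is_derive_barrier (R : realType) (n : nat) (f : 'cV[R]_n -> R) (mu : R)
    (x v : 'cV[R]_n) : (forall i, 0 < x i ord0) -> differentiable f x ->
  is_derive x v (barrier f mu) ('D_v f x - mu * \sum_i (x i ord0)^-1 * v i ord0).
Proof.
move=> x0 df.
have -> : barrier f mu = f - mu *: \sum_i (fun y : 'cV[R]_n => ln (y i ord0)).
  by apply/funext => y; rewrite /barrier !fctE fct_sumE.
apply: is_deriveB; first exact/derivableP/diff_derivable.
apply: is_deriveZ; apply: is_derive_sum => i.
exact/is_derive_coord/is_derive1_ln.
Qed.

Lemma grad_barrier (R : realType) (n : nat) (f : 'cV[R]_n -> R) (mu : R)
    (x : 'cV[R]_n) i : (forall i, 0 < x i ord0) -> differentiable f x ->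
  grad (barrier f mu) x i ord0 = grad f x i ord0 - mu / x i ord0.
Proof.
move=> x0 df; rewrite !mxE.
have [_ ->] := is_derive_barrier mu (delta_mx i ord0) x0 df.
rewrite (bigD1 i) //= big1 => [|j ji]; first by rewrite !mxE !eqxx mulr1 addr0.
by rewrite !mxE (negPf ji) mulr0.
Qed.

Lemma hess_barrier (R : realType) (n : nat) (f : 'cV[R]_n -> R) (mu : R)
    (x : 'cV[R]_n) : (forall i, 0 < x i ord0) -> twice_differentiable f x ->
  hess (barrier f mu) x = hess f x + diag_mx (\row_i (mu / x i ord0 ^+ 2)).
Proof.
move=> x0 [df dg]; apply/matrixP => i j; rewrite !mxE.
set ej := delta_mx j ord0; set ei := delta_mx i ord0.
(* A derivative at x sees only nearby points, and there all coordinates are still positive and f is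
   differentiable, so the formula for the gradient of the barrier can be substituted. *)
have ng : \near x, 'D_ei f x - mu / x i ord0 = 'D_ei (barrier f mu) x.
  near=> y.
  have y0 : forall i, 0 < y i ord0 by near: y; exact: near_pos.
  have dy : differentiable f y by near: y.
  by have := grad_barrier mu i y0 dy; rewrite !mxE => ->.
rewrite -(near_eq_derive _ ng).
have dgi : derivable (fun y => 'D_ei f y) x ej.
  have := (derivable_mxP _ _ _).1 (diff_derivable (v := ej) dg) i ord0.
  by under eq_fun do rewrite mxE.
have d1 : is_derive x ej (fun y : 'cV[R]_n => mu * (y i ord0)^-1)
    (mu * (- (x i ord0) ^- 2) * ej i ord0).
  apply: (is_derive_coord (F := fun t => mu * t^-1)).
  have xi : x i ord0 != 0 by rewrite gt_eqF.
  have : is_derive (x i ord0) 1 (fun t : R => t^-1) (- (x i ord0) ^- 2).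
    apply: is_derive_eq; first exact: (is_deriveV (f := id)).
    by rewrite /GRing.scale /= mulr1.
  move=> dv; exact: (is_deriveZ (f := fun t : R => t^-1)).
have [_ ->] := is_deriveB (derivableP dgi) d1.
congr (_ + _); rewrite /ej !mxE eqxx andbT.
by case: (i == j); rewrite ?mulr1 ?mulr0 ?oppr0 ?mulrN ?opprK.
Unshelve. all: by end_near. Qed.

Lemma Dx_mulE (R : realType) (n : nat) (x u : 'cV[R]_n) i :
  (Dx x *m u) i ord0 = x i ord0 * u i ord0.
Proof. by rewrite /Dx mul_diag_mx !mxE. Qed.

Lemma Dbar_mulE (R : realType) (n : nat) (x u : 'cV[R]_n) i :
  (Dbar x *m u) i ord0 = Num.min (x i ord0) 1 * u i ord0.
Proof. by rewrite Dx_mulE mxE. Qed.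

Lemma Dratio_mulE (R : realType) (n : nat) (x u : 'cV[R]_n) i :
  (forall i, 0 < x i ord0) ->
  (Dratio x *m u) i ord0 = Num.min (x i ord0) 1 / x i ord0 * u i ord0.
Proof.
move=> x0.
have ux : Dx x \in unitmx.
  rewrite unitmxE det_diag unitfE; apply/prodf_neq0 => k _.
  by rewrite mxE gt_eqF.
have -> : Dratio x = Dx (\col_k (Num.min (x k ord0) 1 / x k ord0)).
  rewrite /Dratio -[RHS](mulKmx ux); congr (_ *m _).
  rewrite /Dbar /Dx mulmx_diag; congr diag_mx; apply/rowP => k.
  by rewrite !mxE mulrCA mulfV ?mulr1 // gt_eqF.
by rewrite Dx_mulE mxE.
Qed.

Lemma Dbar_sym (R : realType) (n : nat) (x : 'cV[R]_n) : (Dbar x)^T = Dbar x.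
Proof. by rewrite /Dbar /Dx tr_diag_mx. Qed.

(** For t >= 0 the quadratic alone suffices, since -1/(1+s) <= -1 + s. For t < 0 and u = -t,
    integrate 1/(1-s) = 1 + s + s^2/(1-s) <= 1 + s + s^2/(1-b) over [0, u]. *)
Lemma neg_ln1Dx_le (R : realType) (b t : R) : 0 < b < 1 -> `|t| <= b ->
  - ln (1 + t) <= - t + t ^+ 2 / 2 + `|t| ^+ 3 / (3 * (1 - b)).
Proof.
move=> /andP[b0 b1] tb.
have dln (c s : R) : 0 < 1 + c * s ->
    is_derive s 1 (fun s : R => - ln (1 + c * s)) (- ((1 + c * s)^-1 * c)).
  move=> cs; apply: is_deriveN.
  apply: (is_derive1_comp (f := @ln R) (g := fun s : R => 1 + c * s)).
    exact: is_derive1_ln.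
  apply: is_derive_eq; rewrite /GRing.scale /=; ring.
have cb : 0 < 1 - b by lra.
have [t0|t0] := leP 0 t.
  rewrite ger0_norm // in tb *.
  have dh (s : R) : 0 <= s <= t ->
      is_derive s 1 (fun s : R => - ln (1 + 1 * s)) (- ((1 + 1 * s)^-1 * 1)).
    by move=> /andP[s0 st]; apply: dln; lra.
  have := le_of_derive t0 dh (fun s _ => is_derive_quad (-1) 1 s).
  rewrite !mul1r addr0 ln1 expr0n /= => H.
  have {}H : - ln (1 + t) <= - t + t ^+ 2 / 2.
    suff le s : 0 <= s <= t -> - ((1 + 1 * s)^-1 * 1) <= -1 + 1 * s by have := H le; lra.
    move=> /andP[s0 st]; rewrite mulr1 mul1r lerNl -div1r ler_pdivlMr; last lra.
    by nra.
  apply: le_trans H _; rewrite lerDl; apply: divr_ge0; first exact: exprn_ge0.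
  by apply: mulr_ge0 => //; exact: ltW.
rewrite (ltr0_norm t0) in tb *.
set u := - t in tb *.
have -> : t = -1 * u by rewrite /u; ring.
have u0 : 0 <= u by rewrite /u; lra.
have dh (s : R) : 0 <= s <= u ->
    is_derive s 1 (fun s : R => - ln (1 + -1 * s)) (- ((1 + -1 * s)^-1 * -1)).
  by move=> /andP[s0 su]; apply: dln; lra.
have := le_of_derive u0 dh (fun s _ => is_derive_cubic 1 1 (2 / (1 - b)) s).
rewrite !mulr0 addr0 ln1 !expr0n /= => H.
have le s : 0 <= s <= u -> - ((1 + -1 * s)^-1 * -1) <= 1 + 1 * s + 2 / (1 - b) * s ^+ 2 / 2.
  move=> /andP[s0 su]; rewrite mulrN1 opprK mulN1r mul1r.
  have s1 : 0 < 1 - s by lra.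
  have -> : 2 / (1 - b) * s ^+ 2 / 2 = s ^+ 2 / (1 - b) by field; rewrite gt_eqF.
  have -> : (1 - s)^-1 = 1 + s + s ^+ 2 / (1 - s) by field; rewrite gt_eqF.
  by rewrite lerD2l ler_wpM2l ?sqr_ge0 // lef_pV2 ?posrE //; lra.
apply: le_trans (_ : - ln (1 + -1 * u) <= 1 * u + 1 * u ^+ 2 / 2 + 2 / (1 - b) * u ^+ 3 / 6) _.
  by have := H le; lra.
rewrite le_eqVlt; apply/orP; left; apply/eqP; field; rewrite gt_eqF //.
Qed.

(** * Capped conjugate gradients *)

(** The Gram matrix of n + 1 such vectors would be diagonal and invertible, yet it factors through a
    space of dimension n. *)
Lemma orthogonal_family_small (R : realType) (n : nat) (r : nat -> 'cV[R]_n) :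
  (forall i, (i < n.+1)%N -> r i != 0) ->
  (forall i j, (i < j < n.+1)%N -> dot (r j) (r i) = 0) -> False.
Proof.
move=> nz orth.
pose A := \matrix_(i < n.+1, k < n) r i k ord0.
have AA : A *m A^T = diag_mx (\row_i dot (r i) (r i)).
  apply/matrixP => i j.
  have -> : (A *m A^T) i j = dot (r i) (r j).
    by rewrite dotE mxE; apply: eq_bigr => k _; rewrite !mxE.
  rewrite !mxE; have [->|ij] := eqVneq i j; first by rewrite mulr1n.
  rewrite mulr0n; move: ij; rewrite -val_eqE neq_ltn => /orP[] ij.
    by rewrite dotC orth // ij /=.
  by rewrite orth // ij /=.
have uA : A *m A^T \in unitmx.
  rewrite AA unitmxE det_diag unitfE; apply/prodf_neq0 => k _.
  by rewrite mxE dot_eq0 nz.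
have := mxrankM_maxl A A^T; rewrite mxrank_unit // => h.
by have := leq_trans h (rank_leq_col A); rewrite ltnn.
Qed.

Lemma ccg_nc_neg_curv (R : realType) (n : nat) (I : ccg_input R n) (dh : 'cV[R]_n) :
  ccg_returns I dh NC -> neg_curv I dh.
Proof.
move=> h; inversion h as [|j d ty _ _ _ ex]; subst => //.
by inversion ex; subst.
Qed.

Section CappedCG.
Variables (R : realType) (n : nat) (I : ccg_input R n).
Hypothesis Bsym : (ccg_Hbar I)^T = ccg_Hbar I.
Hypothesis g0 : ccg_g I != 0.
Hypothesis eps0 : 0 < ccg_eps I.
Hypothesis zr01 : 0 < ccg_zr I < 1.
Hypothesis cmu0 : 0 <= ccg_cmu I.
Hypothesis M00 : 0 <= ccg_M0 I.

Local Notation B := (ccg_Hbar I).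
Local Notation r j := (ccg_r (ccg_iter I j)).
Local Notation p j := (ccg_p (ccg_iter I j)).
Local Notation y j := (ccg_y (ccg_iter I j)).
Local Notation a j := (ccg_a I (ccg_iter I j)).
Local Notation b j := (enorm (r j.+1) ^+ 2 / enorm (r j) ^+ 2).

Lemma ccg_rS j : r j.+1 = r j + a j *: (B *m p j).
Proof. by []. Qed.

Lemma ccg_yS j : y j.+1 = y j + a j *: p j.
Proof. by []. Qed.

Lemma ccg_pS j : p j.+1 = - r j.+1 + b j *: p j.
Proof. by []. Qed.

Lemma dot_symB u v : dot u (B *m v) = dot v (B *m u).
Proof. by rewrite dot_mulmxr Bsym dotC. Qed.

Lemma ccg_raise_ge0 (H : 'M[R]_n) M zs : 0 <= M -> 0 <= ccg_raise H M zs.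
Proof.
move=> M0; elim: zs => //= z zs IH; case: ifP => // _.
by rewrite divr_ge0 ?enorm_ge0.
Qed.

Lemma ccg_M_ge0 j : 0 <= ccg_M (ccg_iter I j).
Proof. by elim: j => [|j IH]; apply: ccg_raise_ge0. Qed.

(** However often M is raised it stays nonnegative, so kappa >= 2. Being below 1 ensures that the
    residual g of y = 0 never passes the test; being nonnegative, that a zero residual always meets
    it. *)
Lemma ccg_zeta_lt1 j :
  0 <= ccg_zeta (ccg_eps I) (ccg_zr I) (ccg_M (ccg_iter I j)) < 1.
Proof.
have /andP[z0 z1] := zr01; have M0 := ccg_M_ge0 j; rewrite /ccg_zeta.
have k2 : 2 <= ccg_kappa (ccg_eps I) (ccg_M (ccg_iter I j)).
  by rewrite /ccg_kappa ler_pdivlMr //; lra.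
have k0 : 0 < 3 * ccg_kappa (ccg_eps I) (ccg_M (ccg_iter I j)) by lra.
by rewrite divr_ge0 ?(ltW z0) ?(ltW k0) //= ltr_pdivrMr // mul1r; lra.
Qed.

Lemma ccg_residual j : r j = ccg_g I + B *m y j.
Proof.
elim: j => [|j IH]; first by rewrite mulmx0 addr0.
by rewrite ccg_rS ccg_yS IH mulmxDr -scalemxAr addrA.
Qed.

(** Before index j the recurrences divide only by nonzero quantities, so the algebra of ordinary
    conjugate gradients is valid. *)
Definition ccg_good j := forall i, (i < j)%N -> r i != 0 /\ 0 < quad B (p i).

(** The four relations need a simultaneous induction: orthogonality to the directions gives
    orthogonality to the residuals, as r_i is a combination of p_i and p_(i-1), and conjugacy then
    follows from a_i B p_i = r_(i+1) - r_i. *)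
Lemma ccg_orthogonality j : ccg_good j ->
  [/\ forall i, (i < j)%N -> dot (r j) (p i) = 0,
      forall i, (i < j)%N -> dot (r j) (r i) = 0,
      forall i, (i < j)%N -> dot (p j) (B *m p i) = 0 &
      dot (r j) (p j) = - enorm (r j) ^+ 2].
Proof.
elim: j => [_|j IH good].
  by split => //=; rewrite dotNr enorm_sqr.
have [|rp rr pp rpj] := IH; first by move=> i ij; apply: good; rewrite ltnS ltnW.
have [rj0 qj0] := good j (ltnSn j).
have nj0 : enorm (r j) ^+ 2 != 0 by rewrite sqrf_eq0 enorm_eq0.
have A i : (i < j.+1)%N -> dot (r j.+1) (p i) = 0.
  rewrite ltnS leq_eqVlt => /predU1P[->|ij].
    rewrite ccg_rS dotDl dotZl rpj (dotC (B *m _)) -/(quad B (p j)) /ccg_a.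
    by rewrite divfK ?gt_eqF // addNr.
  by rewrite ccg_rS dotDl dotZl rp // dotC dot_symB pp // mulr0 addr0.
have Br i : (i < j.+1)%N -> dot (r j.+1) (r i) = 0.
  case: i => [_|i ij].
    have -> : r 0 = - p 0 := esym (opprK (ccg_g I)).
    by rewrite dotNr A // oppr0.
  have -> : r i.+1 = b i *: p i - p i.+1 by rewrite [in RHS]ccg_pS opprD opprK addrCA subrr addr0.
  by rewrite dotBr dotZr !A ?mulr0 ?subrr // ltnW.
have Ba i : (i < j.+1)%N -> a i != 0 /\ a i *: (B *m p i) = r i.+1 - r i.
  move=> ij; split; last by rewrite ccg_rS addrC addKr.
  have [ri qi] := good i ij.
  by apply: mulf_neq0; [rewrite sqrf_eq0 enorm_eq0 | rewrite invr_eq0 gt_eqF].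
split => //.
- move=> i ij; have [ai e] := Ba i ij.
  apply: (mulfI ai); rewrite mulr0 -dotZr e.
  (* Against earlier residuals the new one drops out of p_(j+1). For i < j conjugacy is thus
     inherited from p_j; for i = j the choice of b_(j+1) makes the two contributions cancel. *)
  have D k : (k < j.+1)%N -> dot (p j.+1) (r k) = b j * dot (p j) (r k).
    by move=> kj; rewrite ccg_pS dotDl dotNl dotZl Br // oppr0 add0r.
  move: ij; rewrite ltnS leq_eqVlt => /predU1P[eij|ij].
    rewrite eij dotBr (D j (ltnSn j)) (dotC _ (r j)) rpj (ccg_pS j) dotDl dotNl dotZl.
    rewrite -enorm_sqr (dotC (p j)) (A j (ltnSn j)) mulr0 addr0 mulrN divfK //.
    by rewrite opprK addNr.
  rewrite dotBr !D ?ltnS // ?(ltnW ij) // -mulrBr -dotBr -e dotZr pp //.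
  by rewrite !mulr0.
- by rewrite [X in dot _ X]ccg_pS dotDr dotNr dotZr A // mulr0 addr0 enorm_sqr.
Qed.

(** This Galerkin condition is what later ties the slope g.d to the curvature of the regularised
    matrix along a solution direction. *)
Lemma ccg_r_orth_y j : ccg_good j -> dot (r j) (y j) = 0.
Proof.
move=> /ccg_orthogonality[rp _ _ _].
suff : forall i, (i <= j)%N -> dot (r j) (y i) = 0 by apply.
elim => [_|i IH ij]; first by rewrite dot0r.
by rewrite ccg_yS dotDr dotZr IH ?rp ?mulr0 ?addr0 // ltnW.
Qed.

(** At an index k >= 1 a zero residual would trigger the first or second test, and a direction of
    low curvature one of the first three. Index 0 is covered by g != 0 and the initial test. *)
Lemma ccg_good_before j : ~~ neg_curv I (- ccg_g I) ->
  (forall i d ty, (0 < i < j)%N -> ~ ccg_exit I i d ty) -> ccg_good j.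
Proof.
move=> n0 noexit; suff : forall k, (k <= j)%N -> ccg_good k by apply.
elim => // k IH kj i; rewrite ltnS leq_eqVlt => /predU1P[->|ik]; last first.
  by apply: IH => //; apply: ltnW.
have good : ccg_good k by apply: IH; apply: ltnW.
have [_ _ _ rp] := ccg_orthogonality good.
have rk0 : r k != 0.
  case: k kj {IH good rp} => // k kj; apply/eqP => rk.
  have [ny|ny] := boolP (neg_curv I (y k.+1)).
    exact: (noexit k.+1 _ _ kj (ExitY ny)).
  apply: (noexit k.+1 _ _ kj (ExitSol ny _)); rewrite /ccg_solved rk normr0 cmu0 andbT.
  have /andP[z0 _] := ccg_zeta_lt1 k.+1.
  have -> : enorm (0 : 'cV[R]_n) = 0 by apply/eqP; rewrite enorm_eq0.
  by rewrite mulr_ge0 ?enorm_ge0.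
split => //.
have nk : ~~ neg_curv I (p k).
  case: k kj {IH good rp} rk0 => // k kj _; apply/negP => np.
  have [ny|ny] := boolP (neg_curv I (y k.+1)).
    exact: (noexit k.+1 _ _ kj (ExitY ny)).
  have [sol|nsol] := boolP (ccg_solved I (ccg_iter I k.+1)).
    exact: (noexit k.+1 _ _ kj (ExitSol ny sol)).
  exact: (noexit k.+1 _ _ kj (ExitP ny nsol np)).
(* The curvature test only gives quad >= eps |p|^2, which is positive once p is nonzero; this
   follows from r.p = -|r|^2. *)
have pk0 : p k != 0.
  apply/eqP => pk; move: rp; rewrite pk dot0r => /esym/eqP.
  by rewrite oppr_eq0 sqrf_eq0 enorm_eq0 (negPf rk0).
apply: lt_le_trans (_ : 0 < ccg_eps I * enorm (p k) ^+ 2) _.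
  by rewrite mulr_gt0 // exprn_gt0 // enorm_gt0.
by rewrite leNgt.
Qed.

(* Termination comes from orthogonality alone: the test on the decay of the
   residual only makes the exit earlier. *)
Lemma ccg_terminates : exists dh ty, ccg_returns I dh ty.
Proof.
have [ng|ng] := boolP (neg_curv I (- ccg_g I)).
  by exists (- ccg_g I), NC; apply: ReturnsFirst.
have [[j [j0 [d [ty ex]]]]|no] :=
  pselect (exists j, (0 < j)%N /\ exists d ty, ccg_exit I j d ty).
  pose P := fun j => `[< (0 < j)%N /\ exists d ty, ccg_exit I j d ty >].
  have exP : exists j, P j by exists j; apply/asboolP; split => //; exists d, ty.
  have [m /asboolP[m0 [d' [ty' ex']]] mmin] := ex_minnP exP.
  exists d', ty'; apply: (ReturnsLoop ng m0 _ ex') => i e t /andP[i0 im] exi.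
  have /mmin : P i by apply/asboolP; split => //; exists e, t.
  by rewrite leqNgt im.
exfalso.
have good j : ccg_good j.
  apply: ccg_good_before => // i d ty /andP[i0 _] ex; apply: no.
  by exists i; split => //; exists d, ty.
apply: (@orthogonal_family_small R n (fun j => r j)) => [i _|i j /andP[ij _]].
  by have [] := good i.+1 i (ltnSn i).
by have [_ rr _ _] := ccg_orthogonality (good j); apply: rr.
Qed.

Lemma ccg_solP dh : ccg_returns I dh SOL ->
  [/\ dh != 0, ccg_eps I * enorm dh ^+ 2 <= quad B dh,
      dot (ccg_g I + B *m dh) dh = 0 &
      `|ccg_g I + B *m dh| <= ccg_cmu I].
Proof.
move=> h; inversion h as [|j d ty ng j0 noexit ex]; subst.
have good := ccg_good_before ng noexit.
inversion ex as [|ny sol| |]; subst.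
move/andP: sol => [sol rc].
rewrite -ccg_residual; split => //; last exact: ccg_r_orth_y.
- apply/eqP => y0; move: sol; rewrite ccg_residual y0 mulmx0 addr0.
  have /andP[_ z1] := ccg_zeta_lt1 j; rewrite -subr_ge0 -{2}[enorm _]mul1r -mulrBl.
  by rewrite pmulr_lge0 ?enorm_gt0 // subr_ge0 leNgt z1.
- by rewrite leNgt.
Qed.

End CappedCG.

(** * Scaled model and line search *)

Lemma enorm_le (R : realType) (n : nat) (u v : 'cV[R]_n) :
  (forall i, `|u i ord0| <= `|v i ord0|) -> enorm u <= enorm v.
Proof.
move=> le; rewrite -(ler_pXn2r (n := 2)) ?nnegrE ?enorm_ge0 // !sqr_enormE.
apply: ler_sum => i _; rewrite -[leLHS]real_normK ?num_real //.
by rewrite -[leRHS]real_normK ?num_real // ler_pXn2r ?nnegrE.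
Qed.

Lemma sum_cube_le (R : realType) (n : nat) (u v : 'cV[R]_n) :
  (forall i, `|u i ord0| <= `|v i ord0|) ->
  \sum_i `|u i ord0| ^+ 3 <= enorm v ^+ 3.
Proof.
move=> le; rewrite exprSr sqr_enormE mulr_suml; apply: ler_sum => i _.
rewrite exprSr -[v i ord0 ^+ 2]real_normK ?num_real //.
by rewrite ler_pM ?sqr_ge0 ?ler_pXn2r ?nnegrE // (le_trans (le i)) // coord_le_enorm.
Qed.

Section ScaledVariables.
Variables (R : realType) (n : nat) (x : 'cV[R]_n).
Hypothesis x0 : forall i, 0 < x i ord0.

Definition xbar i : R := Num.min (x i ord0) 1.
(** The diagonal of X^-1 Xbar, that is min(1, 1/x_i): a scaled step d changes x_i by the relative
    amount rho_i d_i. *)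
Definition rho i : R := xbar i / x i ord0.

Lemma xbar_bounds i : 0 < xbar i <= 1.
Proof. by rewrite /xbar lt_min x0 ltr01 ge_min lexx orbT. Qed.

Lemma xbar_rho i : rho i * x i ord0 = xbar i.
Proof. by rewrite divfK // gt_eqF. Qed.

Lemma rho_bounds i : 0 < rho i <= 1.
Proof.
have /andP[b0 _] := xbar_bounds i.
by rewrite /rho divr_gt0 // ler_pdivrMr // mul1r /xbar ge_min lexx.
Qed.

Lemma Dbar_coord_le (u : 'cV[R]_n) i : `|(Dbar x *m u) i ord0| <= `|u i ord0|.
Proof.
have /andP[b0 b1] := xbar_bounds i.
by rewrite Dbar_mulE normrM ger0_norm ?(ltW b0) // ler_piMl.
Qed.

Lemma Dratio_coord_le (u : 'cV[R]_n) i : `|(Dratio x *m u) i ord0| <= `|u i ord0|.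
Proof.
have /andP[b0 b1] := rho_bounds i.
by rewrite Dratio_mulE // normrM ger0_norm ?(ltW b0) // ler_piMl.
Qed.

Lemma enorm_Dbar_le (u : 'cV[R]_n) : enorm (Dbar x *m u) <= enorm u.
Proof. by apply: enorm_le => i; exact: Dbar_coord_le. Qed.

Lemma norm_Dratio_le (u : 'cV[R]_n) : `|Dratio x *m u| <= enorm u.
Proof.
apply: norm_leP (enorm_ge0 _) _ => i.
by apply: le_trans (Dratio_coord_le _ _) _; exact: coord_le_enorm.
Qed.

Lemma norm_Dratio_gt0 (u : 'cV[R]_n) : u != 0 -> 0 < `|Dratio x *m u|.
Proof.
move=> u0; rewrite normr_gt0; apply: contraNneq u0 => e.
apply/eqP/matrixP => i j; rewrite (ord1 j) mxE; apply/eqP.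
have := Dratio_mulE u i x0; rewrite e mxE => /esym/eqP.
by have /andP[r0 _] := rho_bounds i; rewrite mulf_eq0 gt_eqF.
Qed.

(** The new coordinate is x_i (1 + a rho_i u_i), and the truncation keeps the relative change above
    -1. *)
Lemma pos_step (u : 'cV[R]_n) (a b : R) i : 0 <= a <= 1 -> b < 1 ->
  `|Dratio x *m u| <= b -> 0 < (x + a *: (Dbar x *m u)) i ord0.
Proof.
move=> /andP[a0 a1] b1 ub.
have : `|rho i * u i ord0| <= b.
  by rewrite -Dratio_mulE //; apply: le_trans (coord_le_norm _ _) ub.
rewrite mxE [X in _ + X]mxE Dbar_mulE -/(xbar i) -xbar_rho.
have := x0 i; move: (rho i) (x i ord0) (u i ord0) => r xi ui xi0 h.
have -> : xi + a * (r * xi * ui) = xi * (1 + a * (r * ui)) by ring.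
have b0 : 0 <= b := le_trans (normr_ge0 _) h.
rewrite mulr_gt0 //; move: h; rewrite ler_norml => /andP[h _].
have := mulr_ge0 a0 (_ : 0 <= r * ui + b).
have : 0 <= b * (1 - a) by rewrite mulr_ge0 // subr_ge0.
by lra.
Qed.

End ScaledVariables.

Section BarrierModel.
Variables (R : realType) (n : nat) (f : 'cV[R]_n -> R) (q : lbncg_params R).
Variables (x : 'cV[R]_n).
Hypothesis x0 : forall i, 0 < x i ord0.
Hypothesis fx : twice_differentiable f x.

Lemma lb_gE i : lb_g f q x i ord0
  = xbar x i * grad f x i ord0 - lb_mu q * rho x i.
Proof.
rewrite /lb_g Dbar_mulE grad_barrier //; last exact: nbhs_singleton fx.1.
by rewrite mulrBr; congr (_ - _); rewrite /rho mulrCA.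
Qed.

Lemma dot_lb_g (u : 'cV[R]_n) : dot (lb_g f q x) u
  = dot (grad f x) (Dbar x *m u) - lb_mu q * \sum_i rho x i * u i ord0.
Proof.
rewrite !dotE mulr_sumr -sumrB; apply: eq_bigr => i _.
rewrite lb_gE Dbar_mulE -/(xbar x i).
move: (grad f x i ord0) (xbar x i) (rho x i) (u i ord0) (lb_mu q) => a b c d e.
by ring.
Qed.

Lemma lb_H_mulE (u : 'cV[R]_n) i : (lb_H f q x *m u) i ord0
  = xbar x i * (hess f x *m (Dbar x *m u)) i ord0
    + lb_mu q * (rho x i ^+ 2 * u i ord0).
Proof.
rewrite /lb_H hess_barrier // -!mulmxA Dbar_mulE -/(xbar x i) mulmxDl.
set w := hess f x *m _.
have -> (v : 'cV[R]_n) : (w + v) i ord0 = w i ord0 + v i ord0 by rewrite mxE.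
have -> (v : 'rV[R]_n) (z : 'cV[R]_n) : (diag_mx v *m z) i ord0 = v ord0 i * z i ord0.
  by rewrite mul_diag_mx mxE.
rewrite [in X in _ * (_ + X * _)]mxE Dbar_mulE -/(xbar x i) mulrDr.
congr (_ + _); rewrite /rho; have : x i ord0 != 0 by rewrite gt_eqF.
move: (w i ord0) (x i ord0) (xbar x i) (u i ord0) (lb_mu q) => a b c d e b0.
by field.
Qed.

Lemma quad_lb_H (u : 'cV[R]_n) : quad (lb_H f q x) u
  = quad (hess f x) (Dbar x *m u) + lb_mu q * \sum_i (rho x i * u i ord0) ^+ 2.
Proof.
rewrite /quad !dotE mulr_sumr -big_split; apply: eq_bigr => i _.
rewrite lb_H_mulE Dbar_mulE -/(xbar x i).
move: (hess f x *m _) => w.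
move: (w i ord0) (xbar x i) (rho x i) (u i ord0) (lb_mu q) => a b c d e.
by rewrite /=; ring.
Qed.

Lemma quad_scaled_hess (u : 'cV[R]_n) :
  quad (scaled_hess f x) u = quad (hess f x) (Dbar x *m u).
Proof.
by rewrite /quad /scaled_hess -!mulmxA dot_mulmxr Dbar_sym.
Qed.

Lemma lb_H_sym : (hess f x)^T = hess f x -> (lb_H f q x)^T = lb_H f q x.
Proof.
move=> hs; rewrite /lb_H !trmx_mul Dbar_sym mulmxA hess_barrier //.
by rewrite linearD /= hs tr_diag_mx.
Qed.

End BarrierModel.

(** The first and second order terms of f and of the barrier add up exactly to the scaled model.
    Both cubic remainders are controlled by (a |d|)^3 because neither Xbar nor X^-1 Xbar increases
    absolute values of coordinates. *)
Lemma barrier_descent (R : realType) (n : nat) (f : 'cV[R]_n -> R)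
    (q : lbncg_params R) (U : set 'cV[R]_n) (Lg LH : R) (x d : 'cV[R]_n)
    (a b : R) : 0 < LH -> twice_lipschitz_on f U Lg LH ->
  (forall i, 0 < x i ord0) -> 0 <= a <= 1 -> 0 < b < 1 -> 0 < lb_mu q ->
  (forall t : R, 0 <= t <= 1 -> U (x + t *: (a *: (Dbar x *m d)))) ->
  `|Dratio x *m d| <= b ->
  lb_phi f q (x + a *: (Dbar x *m d)) <=
    lb_phi f q x + a * dot (lb_g f q x) d + a ^+ 2 / 2 * quad (lb_H f q x) d
    + (LH + 2 * lb_mu q / (1 - b)) / 6 * (a * enorm d) ^+ 3.
Proof.
move=> LH0 fU x0 /andP[a0 a1] /andP[b0 b1] mu0 seg db.
have Ux : U x by have := seg 0; rewrite scale0r addr0 lexx ler01; apply.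
have fx : twice_differentiable f x by have [h _ _] := fU; apply: h.
have ft := taylor2_segment fU seg.
have en : enorm (a *: (Dbar x *m d)) <= a * enorm d.
  by rewrite enormZ ger0_norm // ler_wpM2l // enorm_Dbar_le.
have en3 : LH / 6 * enorm (a *: (Dbar x *m d)) ^+ 3 <= LH / 6 * (a * enorm d) ^+ 3.
  apply: ler_wpM2l; first by rewrite divr_ge0 // ltW.
  by rewrite ler_pXn2r // nnegrE ?mulr_ge0 ?enorm_ge0.
pose t i := a * (rho x i * d i ord0).
have tb i : `|t i| <= b.
  have h : `|rho x i * d i ord0| <= b.
    by rewrite -Dratio_mulE //; apply: le_trans (coord_le_norm _ _) db.
  by rewrite /t normrM (ger0_norm a0) (le_trans _ h) // ler_piMl.
have xt i : (x + a *: (Dbar x *m d)) i ord0 = x i ord0 * (1 + t i).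
  rewrite mxE [X in _ + X]mxE Dbar_mulE -/(xbar x i) -xbar_rho // /t.
  by move: (x i ord0) (rho x i) (d i ord0) => u v w; ring.
have t1 i : 0 < 1 + t i by have := tb i; rewrite ler_norml => /andP[h _]; lra.
have lnt i : - ln ((x + a *: (Dbar x *m d)) i ord0) <=
    - ln (x i ord0) - t i + t i ^+ 2 / 2 + `|t i| ^+ 3 / (3 * (1 - b)).
  rewrite xt lnM ?posrE //.
  have b01 : 0 < b < 1 by rewrite b0.
  have := neg_ln1Dx_le b01 (tb i); lra.
have lnS : - \sum_i ln ((x + a *: (Dbar x *m d)) i ord0) <=
    - (\sum_i ln (x i ord0)) - a * (\sum_i rho x i * d i ord0)
    + a ^+ 2 / 2 * (\sum_i (rho x i * d i ord0) ^+ 2)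
    + (a * enorm d) ^+ 3 / (3 * (1 - b)).
  have cube : \sum_i `|t i| ^+ 3 <= (a * enorm d) ^+ 3.
    have := sum_cube_le (Dratio_coord_le x0 d).
    rewrite exprMn => h; apply: le_trans (ler_wpM2l (exprn_ge0 3 a0) h).
    rewrite mulr_sumr le_eqVlt; apply/orP; left; apply/eqP; apply: eq_bigr => i _.
    by rewrite /t normrM (ger0_norm a0) exprMn Dratio_mulE.
  have k0 : 0 <= (3 * (1 - b))^-1 by rewrite invr_ge0; lra.
  apply: le_trans (lerD (lexx _) (ler_wpM2r k0 cube)).
  rewrite !mulr_sumr mulr_suml -!sumrN -!big_split /=; apply: ler_sum => i _.
  apply: le_trans (lnt i) _.
  rewrite le_eqVlt; apply/orP; left; apply/eqP; rewrite /t.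
  by move: (_ / (3 * (1 - b))) (ln _) => u v; ring.
rewrite /lb_phi /barrier dot_lb_g // quad_lb_H //.
move: ft en3 (ler_wpM2l (ltW mu0) lnS).
rewrite dotZr quadZ.
have -> : (LH + 2 * lb_mu q / (1 - b)) / 6 * (a * enorm d) ^+ 3
  = LH / 6 * (a * enorm d) ^+ 3 + lb_mu q * ((a * enorm d) ^+ 3 / (3 * (1 - b))).
  have : 1 - b != 0 by rewrite gt_eqF // subr_gt0.
  by move: (a * enorm d) (1 - b) (lb_mu q) => u v w v0; field.
move: (f _) (f _) (dot _ _) (quad _ _) (\sum_i ln _) (\sum_i ln _).
move: (\sum_i (_ * _)) (\sum_i (_ ^+ 2)).
move: (enorm _ ^+ 3) ((a * enorm d) ^+ 3) (_ / (3 * (1 - b))).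
move=> z1 z2 z3 s1 s2 f1 f2 g h l1 l2; lra.
Qed.

Lemma geometric_small (R : realType) (t c : R) : 0 < t < 1 -> 0 < c ->
  exists j, t ^+ j < c.
Proof.
move=> /andP[t0 t1] c0.
have /cvgrPdist_lt /(_ c c0) [N _ h] : (fun n => t ^+ n) @ \oo --> (0 : R).
  by apply: cvg_expr; rewrite ger0_norm // ltW.
exists N; have := h N (leqnn N).
by rewrite /= sub0r normrN ger0_norm // exprn_ge0 // ltW.
Qed.

(** * Constants of the step estimates *)

Section StepConstants.
Variables (R : realType) (q : lbncg_params R) (LH : R).
Hypothesis hq : params_ok q.
Hypothesis LH0 : 0 < LH.

Lemma eps_H_sqr : eps_H q ^+ 2 = eps_g q.
Proof.
have [[/andP[e0 _] _ _ _] _] := hq.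
by rewrite /eps_H div1r powR12_sqrt ?sqr_sqrtr // ltW.
Qed.

Lemma eps_H_bounds : 0 < eps_H q < 1.
Proof.
have [[/andP[e0 e1] _ _ _] _] := hq.
have h0 : 0 < eps_H q by apply: powR_gt0.
rewrite h0 /= ltNge; apply/negP => h; move: e1; rewrite -eps_H_sqr ltNge.
by rewrite exprn_ege1.
Qed.

Lemma eps_H_le_beta : eps_H q <= beta q.
Proof. by have [_ [/andP[]]] := hq. Qed.

Lemma beta_bounds : 0 < beta q < 1.
Proof.
have [_ [/andP[_ b1] _]] := hq; have /andP[e0 _] := eps_H_bounds.
by rewrite b1 (lt_le_trans e0 eps_H_le_beta).
Qed.

Lemma lb_muE : lb_mu q = eps_H q ^+ 2 / 4.
Proof. by rewrite eps_H_sqr. Qed.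

Lemma lb_mu_bounds : 0 < lb_mu q <= 1 / 4.
Proof.
have /andP[e0 e1] := eps_H_bounds; rewrite lb_muE divr_gt0 ?exprn_gt0 //=.
by rewrite ler_pM2r ?invr_gt0 // exprn_ile1 // ltW.
Qed.

(* Dominates six times the cubic coefficient of the model, plus eta; the
   denominators of c_nc and c_sol are cubic_bound * (1 - beta)^2. *)
Definition cubic_bound : R := LH + eta q + (2 - beta q) / (1 - beta q) ^+ 2.

Lemma cubic_bound_gt0 : 0 < cubic_bound.
Proof.
have [_ [_ /andP[e0 _]]] := hq; have /andP[b0 b1] := beta_bounds.
rewrite /cubic_bound addr_gt0 ?addr_gt0 // divr_gt0 ?exprn_gt0 ?subr_gt0 //.
by rewrite (lt_trans b1) // ltr1n.
Qed.

Lemma cubic_bound_ge :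
  LH + 2 * lb_mu q / (1 - beta q) + eta q <= cubic_bound.
Proof.
have /andP[b0 b1] := beta_bounds; have /andP[m0 m1] := lb_mu_bounds.
have c0 : 0 < 1 - beta q by lra.
rewrite /cubic_bound addrAC lerD2l ler_pdivlMr ?exprn_gt0 //.
have -> : 2 * lb_mu q / (1 - beta q) * (1 - beta q) ^+ 2 = 2 * lb_mu q * (1 - beta q).
  by field; rewrite gt_eqF.
by nra.
Qed.

Lemma cubic_boundE : ((LH + eta q) * (1 - beta q) ^+ 2 + (2 - beta q))
  = cubic_bound * (1 - beta q) ^+ 2.
Proof.
have /andP[b0 b1] := beta_bounds.
rewrite /cubic_bound; have : 1 - beta q != 0 by rewrite gt_eqF // subr_gt0.
by move: (1 - beta q) (2 - beta q) => u v u0; field.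
Qed.

Lemma c_ncE : c_nc q LH = Num.min 1 (3 * theta q / cubic_bound).
Proof.
have /andP[b0 b1] := beta_bounds; have C0 := cubic_bound_gt0.
rewrite /c_nc cubic_boundE; congr Num.min.
have : 1 - beta q != 0 by rewrite gt_eqF // subr_gt0.
move: (1 - beta q) C0 => u C0 u0; field.
by rewrite u0 gt_eqF.
Qed.

Lemma c_solE : c_sol q LH = Num.min (c_d q LH) (6 * theta q ^+ 2 / cubic_bound).
Proof.
have /andP[b0 b1] := beta_bounds; have C0 := cubic_bound_gt0.
rewrite /c_sol cubic_boundE; congr Num.min.
have : 1 - beta q != 0 by rewrite gt_eqF // subr_gt0.
move: (1 - beta q) C0 => u C0 u0; field.
by rewrite u0 gt_eqF.
Qed.

Lemma c_d_gt0 : 0 < c_d q LH.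
Proof.
have [[_ _ /andP[z0 z1] /andP[zb0 zb1]] _] := hq.
rewrite /c_d !lt_min; apply/and3P; split.
- by rewrite divr_gt0 // subr_gt0.
- by rewrite powR_gt0 // divr_gt0 // mulr_gt0.
- by apply: divr_gt0 => //; apply: mulr_gt0 => //; do 2?apply: addr_gt0.
Qed.

Lemma c_all_gt0 : 0 < c_all q LH.
Proof.
have [[_ /andP[t0 t1] _ _] _] := hq; have C0 := cubic_bound_gt0.
rewrite /c_all c_solE c_ncE lt_min; apply/andP; split; rewrite lt_min.
  by rewrite c_d_gt0 divr_gt0 // mulr_gt0 // exprn_gt0.
by rewrite ltr01 divr_gt0 // mulr_gt0.
Qed.

Lemma c_all_le : [/\ c_all q LH <= c_d q LH,
  c_all q LH <= 6 * theta q ^+ 2 / cubic_bound, c_all q LH <= 1 &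
  c_all q LH <= 3 * theta q / cubic_bound].
Proof.
rewrite /c_all c_solE c_ncE.
move: (c_d q LH) (6 * _ / _) (3 * _ / _) => u v w.
by split; rewrite !ge_min lexx ?orbT.
Qed.

(** The 1/4 comes from directions of negative curvature: their length is at least eps_H / 4, and
    their step size at least [c_all]. *)
Definition big_step : R := c_all q LH * eps_H q / 4.

End StepConstants.

(** * Termination and step length of the line search *)

Section Backtracking.
Variables (R : realType) (n : nat) (f : 'cV[R]_n -> R) (q : lbncg_params R).
Variables (U : set 'cV[R]_n) (Lg LH : R) (x d : 'cV[R]_n).
Hypothesis hq : params_ok q.
Hypothesis LH0 : 0 < LH.
Hypothesis fU : twice_lipschitz_on f U Lg LH.
Hypothesis x0 : forall i, 0 < x i ord0.
Hypothesis seg : forall j (t : R), 0 <= t <= 1 ->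
  U (x + t *: (trial_point q x d j - x)).
Hypothesis db : `|Dratio x *m d| <= beta q.

Local Notation C := (cubic_bound q LH).
Local Notation model a :=
  (a * dot (lb_g f q x) d + a ^+ 2 / 2 * quad (lb_H f q x) d).

Lemma theta_pow_bounds j : 0 < theta q ^+ j <= 1.
Proof.
have [[_ /andP[t0 t1] _ _] _] := hq.
by rewrite exprn_gt0 //= exprn_ile1 // ltW.
Qed.

Lemma trial_segment j (t : R) : 0 <= t <= 1 ->
  U (x + t *: (theta q ^+ j *: (Dbar x *m d))).
Proof.
move=> ht; have := seg j ht; rewrite /trial_point.
by have -> : x + theta q ^+ j *: (Dbar x *m d) - x = theta q ^+ j *: (Dbar x *m d)
  by rewrite addrAC subrr add0r.
Qed.

(** [cubic_bound] already contains eta, so a negative majorant is exactly enough for the required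
    cubic decrease. *)
Lemma accepted_model j :
  model (theta q ^+ j) + C / 6 * (theta q ^+ j * enorm d) ^+ 3 < 0 ->
  accepted f q x d j.
Proof.
have /andP[a0 a1] := theta_pow_bounds j.
have /andP[m0 _] := lb_mu_bounds hq.
have a01 : 0 <= theta q ^+ j <= 1 by rewrite a1 ltW.
have D := barrier_descent LH0 fU x0 a01 (beta_bounds hq) m0 (trial_segment j) db.
have G := cubic_bound_ge LH hq.
have K0 : 0 <= (theta q ^+ j * enorm d) ^+ 3.
  by rewrite exprn_ge0 // mulr_ge0 ?enorm_ge0 // ltW.
rewrite /accepted /trial_point => h; apply: le_lt_trans D _.
rewrite -[_ * _ ^+ 3 * enorm d ^+ 3]mulrA -exprMn.
move: h K0 G; move: ((theta q ^+ j * enorm d) ^+ 3) (LH + _ / _) (lb_phi _ _ _) => K L ph.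
move: (dot _ _) (quad _ _) (cubic_bound _ _) (eta q) => g h D e H K0 G.
have := ler_wpM2r K0 G.
by nra.
Qed.

Section Curvature.
Hypothesis d0 : d != 0.
Hypothesis gd : dot (lb_g f q x) d <= 0.
Hypothesis Hd : quad (lb_H f q x) d <= - enorm d ^+ 3.

(** With a = theta^j the majorant is at most a^2 |d|^3 (a C / 6 - 1/2), whence the threshold 3. *)
Lemma curvature_accepted j : theta q ^+ j * C < 3 -> accepted f q x d j.
Proof.
have /andP[a0 a1] := theta_pow_bounds j => h; apply: accepted_model.
have e0 : 0 < enorm d by rewrite enorm_gt0.
move: gd Hd a0 e0 h.
move: (theta q ^+ j) (enorm d) (dot _ _) (quad _ _) C => a e g h D gd' Hd' a0 e0 hD.
have k0 : 0 < a ^+ 2 * e ^+ 3 by rewrite mulr_gt0 ?exprn_gt0.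
have h1 : a * g <= 0 by apply: mulr_ge0_le0 => //; exact: ltW.
have h2 : a ^+ 2 / 2 * h <= a ^+ 2 / 2 * - e ^+ 3.
  by rewrite ler_wpM2l // divr_ge0 ?sqr_ge0.
have h3 : 0 < (a ^+ 2 * e ^+ 3) * (3 - a * D) by rewrite mulr_gt0 // subr_gt0.
have e1 : D / 6 * (a * e) ^+ 3 = (a ^+ 2 * e ^+ 3) * (a * D) / 6 by ring.
rewrite e1; lra.
Qed.

Lemma curvature_search : exists j, accepted f q x d j.
Proof.
have [[_ t01 _ _] _] := hq; have C0 := cubic_bound_gt0 hq LH0.
have [j hj] := geometric_small t01 (divr_gt0 (ltr0Sn R 2) C0).
by exists j; apply: curvature_accepted; rewrite -ltr_pdivlMr.
Qed.

(** The rejected predecessor theta^(j-1) is at least 3 / C, which is the origin of the second entry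
    of [c_nc]; without a rejection the step size is 1. *)
Lemma curvature_step_length j :
  (forall i, (i < j)%N -> ~~ accepted f q x d i) -> c_all q LH <= theta q ^+ j.
Proof.
have [_ _ c1 c2] := c_all_le hq LH0; have C0 := cubic_bound_gt0 hq LH0.
have [[_ /andP[t0 t1] _ _] _] := hq.
case: j => [_|j rej]; first by rewrite expr0.
apply: le_trans c2 _; rewrite exprS mulrAC [leRHS]mulrC ler_wpM2r ?(ltW t0) //.
rewrite ler_pdivrMr // leNgt; apply/negP => h.
by move: (rej j (ltnSn j)); rewrite curvature_accepted.
Qed.

End Curvature.

Section ApproximateNewton.
Hypothesis d0 : d != 0.
Hypothesis model_le : forall a : R, 0 <= a <= 1 ->
  model a <= - (a / 2 * (eps_H q * enorm d ^+ 2)).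

(** With a = theta^j the majorant is at most a |d|^2 (a^2 |d| C / 6 - eps_H / 2). *)
Lemma newton_accepted j :
  (theta q ^+ j) ^+ 2 * enorm d * C < 3 * eps_H q -> accepted f q x d j.
Proof.
have /andP[a0 a1] := theta_pow_bounds j => h; apply: accepted_model.
have a01 : 0 <= theta q ^+ j <= 1 by rewrite a1 ltW.
have := model_le a01.
have e0 : 0 < enorm d by rewrite enorm_gt0.
move: a0 e0 h; move: (theta q ^+ j) (enorm d) (model _) C (eps_H q) => a e g D eh a0 e0 hD gd'.
have h3 : 0 < (a * e ^+ 2) * (3 * eh - a ^+ 2 * e * D).
  by rewrite mulr_gt0 ?subr_gt0 // mulr_gt0 ?exprn_gt0.
have e1 : D / 6 * (a * e) ^+ 3 = (a * e ^+ 2) * (a ^+ 2 * e * D) / 6 by ring.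
rewrite e1; lra.
Qed.

Lemma newton_search : exists j, accepted f q x d j.
Proof.
have [[_ t01 _ _] _] := hq; have C0 := cubic_bound_gt0 hq LH0.
have /andP[eh0 _] := eps_H_bounds hq.
have e0 : 0 < enorm d by rewrite enorm_gt0.
have eC : 0 < enorm d * C by rewrite mulr_gt0.
have [j hj] := geometric_small t01 (divr_gt0 (mulr_gt0 (ltr0Sn R 2) eh0) eC).
exists j; apply: newton_accepted.
have /andP[a0 a1] := theta_pow_bounds j.
rewrite ltr_pdivlMr // in hj; apply: le_lt_trans hj.
by rewrite -mulrA ler_wpM2r ?(ltW eC) // expr2 ler_piMr // ltW.
Qed.

Lemma newton_step_length j : (0 < j)%N ->
  (forall i, (i < j)%N -> ~~ accepted f q x d i) ->
  big_step q LH <= theta q ^+ j * enorm d.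
Proof.
have [_ c2 _ _] := c_all_le hq LH0; have C0 := cubic_bound_gt0 hq LH0.
have /andP[eh0 _] := eps_H_bounds hq.
have [[_ /andP[t0 t1] _ _] _] := hq.
case: j => // j _ rej.
have rj : 3 * eps_H q <= (theta q ^+ j) ^+ 2 * enorm d * C.
  rewrite leNgt; apply/negP => h.
  by move: (rej j (ltnSn j)); rewrite newton_accepted.
have /andP[a0 a1] := theta_pow_bounds j.
have e0 : 0 < enorm d by rewrite enorm_gt0.
rewrite /big_step exprS; move: c2 rj; rewrite ler_pdivlMr //.
move: (c_all q LH) C C0 a0 a1 t0 t1 eh0 e0.
move: (theta q) (theta q ^+ j) (eps_H q) (enorm d) => t a eh e c D D0 a0 a1 t0 t1 eh0 e0 h1 h2.
have t2 : 0 < t ^+ 2 by rewrite exprn_gt0.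
have h3 : 6 * t ^+ 2 * eh <= 2 * t ^+ 2 * (a ^+ 2 * e * D).
  have := ler_wpM2l (ltW t2) h2; lra.
have h4 : c * eh * D <= 2 * t ^+ 2 * (a ^+ 2 * e * D).
  have := ler_wpM2r (ltW eh0) h1; lra.
have h5 : c * eh <= 2 * (t * a * e).
  rewrite -(ler_pM2r D0); apply: le_trans h4 _.
  have -> : 2 * t ^+ 2 * (a ^+ 2 * e * D) = (t * a) * (2 * (t * a * e) * D) by ring.
  rewrite ler_piMl // ?mulr_ge0 ?(ltW t0) ?(ltW a0) ?(ltW e0) ?(ltW D0) //.
  by apply: mulr_ile1 => //; exact: ltW.
have h6 : 0 < t * a * e by rewrite !mulr_gt0.
by lra.
Qed.

End ApproximateNewton.
End Backtracking.

(** * Scaling and truncation of the directions *)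

Section Directions.
Variables (R : realType) (n : nat) (f : 'cV[R]_n -> R) (q : lbncg_params R).
Variable (x : 'cV[R]_n).
Hypothesis hq : params_ok q.
Hypothesis x0 : forall i, 0 < x i ord0.

Lemma norm_Dratio_scale (m : R) (dh : 'cV[R]_n) : dh != 0 -> 0 <= m ->
  m <= beta q / `|Dratio x *m dh| -> `|Dratio x *m (m *: dh)| <= beta q.
Proof.
move=> d0 m0; rewrite ler_pdivlMr ?norm_Dratio_gt0 //.
by rewrite -scalemxAr normrZ ger0_norm.
Qed.

(** X^-1 Xbar does not increase coordinates, so a direction truncated by beta still has length at
    least beta; here the requirement beta >= eps_g^(1/2) enters. *)
Lemma truncated_length (dh : 'cV[R]_n) : dh != 0 ->
  eps_H q <= beta q / `|Dratio x *m dh| * enorm dh.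
Proof.
move=> d0; apply: le_trans (eps_H_le_beta hq) _.
have /andP[b0 _] := beta_bounds hq.
rewrite mulrAC ler_pdivlMr ?norm_Dratio_gt0 // ler_wpM2l ?(ltW b0) //.
exact: norm_Dratio_le.
Qed.

(** The first entry of the minimum would make the curvature exactly -|d|^3. A smaller factor m keeps
    the inequality, since the curvature scales like m^2 and the cube like m^3. *)
Lemma curvature_direction (dh : 'cV[R]_n) (s : R) : dh != 0 ->
  quad (lb_H f q x) dh <= - (eps_H q / 4 * enorm dh ^+ 2) ->
  is_sgn (dot (lb_g f q x) dh) s ->
  let d := (- s * Num.min (`|quad (lb_H f q x) dh| / enorm dh ^+ 3)
                          (beta q / `|Dratio x *m dh|)) *: dh in
  [/\ d != 0, `|Dratio x *m d| <= beta q, dot (lb_g f q x) d <= 0,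
      quad (lb_H f q x) d <= - enorm d ^+ 3 & eps_H q / 4 <= enorm d].
Proof.
move=> dh0 Hdh [s1 sg]; set m := Num.min _ _ => /=.
have /andP[e0 _] := eps_H_bounds hq; have /andP[b0 _] := beta_bounds hq.
have n0 : 0 < enorm dh by rewrite enorm_gt0.
have D0 := norm_Dratio_gt0 x0 dh0.
have q0 : quad (lb_H f q x) dh < 0.
  by apply: le_lt_trans Hdh _; rewrite oppr_lt0 mulr_gt0 ?exprn_gt0 ?divr_gt0.
have m0 : 0 < m by rewrite lt_min !divr_gt0 ?exprn_gt0 // normr_gt0 lt_eqF.
have sE : `|- s * m| = m.
  by rewrite normrM normrN (gtr0_norm m0); case: s1 => ->; rewrite ?normrN1 ?normr1 mul1r.
have s2 : (- s * m) ^+ 2 = m ^+ 2 by rewrite -[LHS]real_normK ?num_real // sE.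
have ms : m * enorm dh ^+ 3 <= - quad (lb_H f q x) dh.
  rewrite -ler_pdivlMr ?exprn_gt0 //.
  by rewrite -(ltr0_norm q0) /m ge_min lexx.
split.
- by rewrite scaler_eq0 negb_or dh0 andbT -normr_gt0 sE.
- rewrite -scalerA -scalemxAr normrZ.
  have -> : `|- s| = 1 by rewrite normrN; case: s1 => ->; rewrite ?normrN1 ?normr1.
  rewrite mul1r; apply: norm_Dratio_scale (ltW m0) _ => //.
  by rewrite /m ge_min lexx orbT.
- by rewrite dotZr !mulNr oppr_le0 mulrAC pmulr_lge0.
- rewrite quadZ s2 enormZ sE exprMn.
  move: ms; move: (quad _ _) (enorm dh) => h e ms.
  have := ler_wpM2l (sqr_ge0 m) ms.
  have -> : m ^+ 2 * (m * e ^+ 3) = m ^+ 3 * e ^+ 3 by ring.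
  by lra.
- rewrite enormZ sE /m minEle; case: ifP => _; last first.
    by apply: le_trans (truncated_length dh0); lra.
  rewrite (ltr0_norm q0) mulrAC ler_pdivlMr ?exprn_gt0 //.
  rewrite exprSr mulrA ler_wpM2r ?(ltW n0) //.
  by rewrite lerNr.
Qed.

Lemma newton_direction (dh : 'cV[R]_n) : dh != 0 ->
  eps_H q * enorm dh ^+ 2 <= quad (lb_H f q x + (2 * eps_H q)%:M) dh ->
  dot (lb_g f q x + (lb_H f q x + (2 * eps_H q)%:M) *m dh) dh = 0 ->
  let d := Num.min 1 (beta q / `|Dratio x *m dh|) *: dh in
  [/\ d != 0, `|Dratio x *m d| <= beta q,
      forall a : R, 0 <= a <= 1 ->
        a * dot (lb_g f q x) d + a ^+ 2 / 2 * quad (lb_H f q x) d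
          <= - (a / 2 * (eps_H q * enorm d ^+ 2)) &
      d = dh \/ eps_H q <= enorm d].
Proof.
move=> dh0 Qdh; rewrite dotDl [dot (_ *m dh) _]dotC -/(quad _ dh) quadD quad_scalar => gQ.
rewrite quadD quad_scalar in Qdh.
set m := Num.min _ _ => /=.
have /andP[e0 _] := eps_H_bounds hq; have /andP[b0 _] := beta_bounds hq.
have n0 : 0 < enorm dh by rewrite enorm_gt0.
have D0 := norm_Dratio_gt0 x0 dh0.
have m0 : 0 < m by rewrite lt_min ltr01 divr_gt0.
have m1 : m <= 1 by rewrite /m ge_min lexx.
split.
- by rewrite scaler_eq0 negb_or dh0 andbT gt_eqF.
- apply: norm_Dratio_scale (ltW m0) _ => //.
  by rewrite /m ge_min lexx orbT.
- move=> a /andP[a0 a1]; rewrite dotZr quadZ enormZ (gtr0_norm m0).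
  move: Qdh gQ n0 m0 m1 e0.
  move: (dot _ _) (quad _ _) (enorm dh) (eps_H q) m => g h e eh k Q gQ n0 k0 k1 e0.
  set T := h + 2 * eh * e ^+ 2 in Q gQ.
  have -> : g = - T by move: gQ; lra.
  have -> : h = T - 2 * eh * e ^+ 2 by rewrite /T; ring.
  have T0 : 0 <= T by apply: le_trans Q; rewrite mulr_ge0 ?sqr_ge0 // ltW.
  have ak0 : 0 <= a * k by rewrite mulr_ge0 // ltW.
  have ak1 : a * k <= 1 by rewrite mulr_ile1 // ltW.
  have s1 : 0 <= 1 - a * k by rewrite subr_ge0.
  have s2 : 0 <= 1 - k by rewrite subr_ge0.
  have s3 : 0 <= T - eh * e ^+ 2 by rewrite subr_ge0.
  have s4 : 0 <= eh * e ^+ 2 by rewrite mulr_ge0 ?sqr_ge0 // ltW.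
  have h1 := mulr_ge0 (mulr_ge0 ak0 s1) T0.
  have h2 := mulr_ge0 ak0 s3.
  have h3 := mulr_ge0 (mulr_ge0 ak0 s2) s4.
  have h4 := mulr_ge0 (sqr_ge0 (a * k)) s4.
  (* The gap between the claimed bound and the model value is displayed as a sum of four nonnegative
     products, one for each of [h1] to [h4]. *)
  have e1 : a * (k * - T) + a ^+ 2 / 2 * (k ^+ 2 * (T - 2 * eh * e ^+ 2))
    = - (a / 2 * (eh * (k * e) ^+ 2))
      - (a * k) * (1 - a * k) * T / 2
      - (a * k) * (T - eh * e ^+ 2) / 2 - a * k * (1 - k) * (eh * e ^+ 2) / 2
      - (a * k) ^+ 2 * (eh * e ^+ 2) by field.
  rewrite e1; lra.
- rewrite enormZ (gtr0_norm m0) /m minEle; case: ifP => _.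
    by left; rewrite scale1r.
  by right; apply: truncated_length.
Qed.

End Directions.

(* The i-th coordinate of the gradient G after a short Newton step d:
   xb = min(x_i, 1), rh = xb / x_i, r is the CCG residual, dl = d_i, w the
   Taylor remainder of the gradient, e = eps_H and E = eps_g. *)
Lemma scaled_gradient_bounds (R : realType) (xb rh G r mu e w dl D z E : R) :
  0 < xb <= 1 -> 0 < rh <= 1 -> (xb = 1 \/ rh = 1) -> 0 < e -> 0 < mu ->
  mu = E / 4 -> 0 < z < 1 -> 0 < E ->
  xb * G = r + mu * rh - mu * (rh ^+ 2 * dl) - 2 * e * dl + xb * w ->
  `|r| <= z * mu -> `|dl| <= D -> e * D <= (1 - z) * E / 36 ->
  mu * D <= (1 - z) * E / 144 -> `|w| <= E / 576 ->
  - E < G /\ `|xb * G| <= 3 / 4 * E.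
Proof.
move=> /andP[xb0 xb1] /andP[rh0 rh1] xr e0 mu0 muE /andP[z0 z1] E0 eq.
rewrite !ler_norml => /andP[r1 r2] /andP[d1 d2] eD mD /andP[w1 w2].
have D0 : 0 <= D by lra.
have rd : `|mu * (rh ^+ 2 * dl) + 2 * e * dl| <= (1 - z) * E / 16.
  have dD : `|dl| <= D by rewrite ler_norml d1 d2.
  apply: le_trans (ler_normD _ _) _; have e2 : 0 < 2 * e by rewrite mulr_gt0.
  rewrite (normrM mu) (normrM (2 * e)) (normrM (rh ^+ 2)) (gtr0_norm mu0).
  rewrite (gtr0_norm (exprn_gt0 2 rh0)) (gtr0_norm e2).
  have h1 : rh ^+ 2 * `|dl| <= D.
    apply: le_trans (_ : 1 * `|dl| <= _); last by rewrite mul1r.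
    by rewrite ler_wpM2r // exprn_ile1 // ltW.
  have h2 := ler_wpM2l (ltW mu0) h1.
  have h3 := ler_wpM2l (ltW e0) dD.
  by lra.
move: rd; rewrite ler_norml => /andP[t1 t2].
have xw1 : - (E / 576) <= xb * w by nra.
have xw2 : xb * w <= E / 576 by nra.
have mr : 0 < mu * rh <= mu by rewrite mulr_gt0 //= ler_piMr // ltW.
have /andP[mr1 mr2] := mr.
have zE : 0 < (1 - z) * E by rewrite mulr_gt0 // subr_gt0.
have zE' : 0 < z * E by rewrite mulr_gt0.
have zmu : z * mu = z * E / 4 by rewrite muE; ring.
have B : - (3 / 4 * E) <= xb * G <= 3 / 4 * E by rewrite eq; apply/andP; split; lra.
split => //.
(* A bound on xb * G says little about G when xb is small. In that case rh = 1, and the full barrier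
   term mu dominates the residual and the terms in dl, which leaves G >= w. *)
case: xr => h.
  by move: B; rewrite h mul1r => /andP[B _]; lra.
have mE : mu * rh = mu by rewrite h mulr1.
have : xb * (w - G) <= 0 by rewrite mulrBr eq; lra.
by rewrite pmulr_rle0 //; lra.
Qed.

Section SmallNewtonStep.
Variables (R : realType) (n : nat) (f : 'cV[R]_n -> R) (q : lbncg_params R).
Variables (U : set 'cV[R]_n) (Lg LH : R) (x d : 'cV[R]_n).
Hypothesis hq : params_ok q.
Hypothesis LH0 : 0 < LH.
Hypothesis fU : twice_lipschitz_on f U Lg LH.
Hypothesis x0 : forall i, 0 < x i ord0.
Hypothesis seg : forall t : R, 0 <= t <= 1 -> U (x + t *: (Dbar x *m d)).

(** The CCG residual and the Taylor remainder express the new gradient, scaled at the old point, as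
    the barrier term mu rho plus small errors. The bound 3/4 eps_g so obtained leaves room for
    passing to the scaling at the new point. *)
Lemma small_newton_step :
  `|lb_g f q x + (lb_H f q x + (2 * eps_H q)%:M) *m d| <= zeta_b q * lb_mu q ->
  enorm d < big_step q LH ->
  ~ first_order_violated f q (x + Dbar x *m d).
Proof.
move=> res dbig.
have Ux : U x by have := @seg 0; rewrite scale0r addr0 lexx ler01; apply.
have fx : twice_differentiable f x by have [h _ _] := fU; apply: h.
have /andP[e0 e1] := eps_H_bounds hq; have /andP[mu0 mu1] := lb_mu_bounds hq.
have [[_ _ /andP[zr0 _] zb] _] := hq; have /andP[zb0 zb1] := zb.
have D0 := enorm_ge0 d.
have [cd _ _ _] := c_all_le hq LH0.
(* The first entry of [c_d] fits the terms linear in d into the margin 1 - zeta_b left by the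
   residual test. The last one gives LH |d| <= eps_H / 8; with eps_H |d| <= eps_g / 36 the remainder
   LH |d|^2 / 2 is at most eps_g / 576. *)
have cd1 : c_d q LH <= (1 - zeta_b q) / 9 by rewrite /c_d ge_min lexx.
have cd2 : c_d q LH <= 1 / (2 * LH).
  apply: (@le_trans _ _ (1 / (2 * (LH + 9 / 2 + zeta_r q)))).
    by rewrite /c_d !ge_min lexx !orbT.
  rewrite !div1r lef_pV2 ?posrE ?mulr_gt0 //; last by do 2?apply: addr_gt0.
  by rewrite ler_pM2l //; lra.
have Dc : enorm d <= c_d q LH * eps_H q / 4.
  apply: ltW; apply: lt_le_trans dbig _; rewrite /big_step ler_pM2r ?invr_gt0 //.
  by rewrite ler_wpM2r // ltW.
have D1 : enorm d <= (1 - zeta_b q) / 36 * eps_H q.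
  by apply: le_trans Dc _; have := ler_wpM2r (ltW e0) cd1; lra.
have D2 : LH * enorm d <= eps_H q / 8.
  rewrite ler_pdivlMr ?mulr_gt0 // in cd2.
  have h1 := ler_wpM2l (ltW LH0) Dc; have h2 := ler_wpM2r (ltW e0) cd2.
  by lra.
have E0 : 0 < eps_g q by rewrite -(eps_H_sqr hq) exprn_gt0.
have muE := lb_muE hq; rewrite (eps_H_sqr hq) in muE.
have eD : eps_H q * enorm d <= (1 - zeta_b q) * eps_g q / 36.
  by have := ler_wpM2l (ltW e0) D1; rewrite -(eps_H_sqr hq); lra.
have mD : lb_mu q * enorm d <= (1 - zeta_b q) * eps_g q / 144.
  have : lb_mu q <= eps_H q / 4.
    by rewrite lb_muE // ler_pM2r ?invr_gt0 // expr2 ler_piMl // ltW.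
  by move=> h; have := ler_wpM2r D0 h; lra.
have wD : LH / 2 * enorm d ^+ 2 <= eps_g q / 576.
  have h1 := ler_wpM2r D0 D2; have := eD.
  have : zeta_b q * eps_g q >= 0 by rewrite mulr_ge0 // ltW.
  by rewrite expr2; lra.
have main i : - eps_g q < grad f (x + Dbar x *m d) i ord0 /\
    `|xbar x i * grad f (x + Dbar x *m d) i ord0| <= 3 / 4 * eps_g q.
  have w := taylor1_segment fU i seg.
  have {}w : `|(grad f (x + Dbar x *m d) - grad f x
      - hess f x *m (Dbar x *m d)) i ord0| <= eps_g q / 576.
    apply: le_trans w _; apply: le_trans wD.
    rewrite ler_wpM2l ?divr_ge0 ?(ltW LH0) // ler_pXn2r ?nnegrE ?enorm_ge0 //.
    exact: enorm_Dbar_le.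
  have ri := le_trans (coord_le_norm _ i) res.
  have xb := xbar_bounds x0 i; have rb := rho_bounds x0 i.
  have xr : xbar x i = 1 \/ rho x i = 1.
    rewrite /rho /xbar minEle; case: ifP => _; last by left.
    by right; rewrite divff // gt_eqF.
  have di := coord_le_enorm d i.
  apply: (scaled_gradient_bounds xb rb xr e0 mu0 muE zb E0 _ ri di eD mD w).
  have addE (u v : 'cV[R]_n) : (u + v) i ord0 = u i ord0 + v i ord0 by rewrite mxE.
  rewrite !mxE_sub mulmxDl !addE mul_scalar_mx lb_gE // lb_H_mulE //.
  have -> : ((2 * eps_H q) *: d) i ord0 = 2 * eps_H q * d i ord0 by rewrite mxE.
  move: (grad f x i ord0) (grad f _ i ord0) ((hess f x *m _) i ord0) => a b c.
  move: (xbar x i) (rho x i) (d i ord0) (lb_mu q) (eps_H q) => u v z mu e.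
  by ring.
case=> [[i]|].
  by rewrite leNgt; have [-> _] := main i.
rewrite ltNge => /negP; apply; apply: norm_leP (ltW E0) _ => i.
rewrite Dbar_mulE; have [_] := main i.
set G := grad f _ i ord0.
have /andP[xb0 xb1] := xbar_bounds x0 i.
have D3 : `|d i ord0| <= 1 / 36.
  apply: le_trans (coord_le_enorm d i) _; apply: le_trans D1 _.
  have : (1 - zeta_b q) * eps_H q <= 1.
    by apply: mulr_ile1; rewrite ?subr_ge0 ?lerBlDr ?lerDl ltW.
  by lra.
(* The scaling at the new point: as |d_i| <= 1/36 it exceeds the old one by a factor of at most
   37/36, and 37/36 times 3/4 is below 1. *)
set y := Num.min ((x + Dbar x *m d) i ord0) 1.
have yp : 0 <= y <= xbar x i * (37 / 36).
  have yx : (x + Dbar x *m d) i ord0 = x i ord0 + xbar x i * d i ord0.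
    by rewrite mxE Dbar_mulE.
  move: D3; rewrite /y yx ler_norml => /andP[D3 D4].
  have xx : xbar x i <= x i ord0 by rewrite /xbar ge_min lexx.
  have h1 : - (1 / 36) * xbar x i <= xbar x i * d i ord0 by nra.
  have h2 : xbar x i * d i ord0 <= 1 / 36 * xbar x i by nra.
  rewrite le_min ler01 andbT; apply/andP; split; first by lra.
  rewrite /xbar in xb0 xb1 xx h1 h2 *; move: xb0 xb1 xx h1 h2.
  have [x1|x1] := leP (x i ord0) 1 => xb0 xb1 xx h1 h2.
    by rewrite ge_min; apply/orP; left; lra.
  by rewrite ge_min; apply/orP; right; lra.
have /andP[y0 y1] := yp.
rewrite !normrM (ger0_norm y0) (gtr0_norm xb0) => h.
apply: (@le_trans _ _ (xbar x i * (37 / 36) * `|G|)); first by rewrite ler_wpM2r.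
by move: h; move: `|G| (xbar x i) => u v h; lra.
Qed.

End SmallNewtonStep.

(** * Progress of one iteration *)

Section Iteration.
Variables (R : realType) (n : nat) (f : 'cV[R]_n.+1 -> R) (q : lbncg_params R).
Variables (U : set 'cV[R]_n.+1) (Lg LH : R) (x : 'cV[R]_n.+1).
Hypothesis hq : params_ok q.
Hypothesis hM : Mhat_ok f q.
Hypothesis LH0 : 0 < LH.
Hypothesis oU : open U.
Hypothesis fU : twice_lipschitz_on f U Lg LH.
Hypothesis Ux : U x.
Hypothesis x0 : forall i, 0 < x i ord0.

Let fx : twice_differentiable f x.
Proof. by have [h _ _] := fU; apply: h. Qed.

(** If the scaled gradient of the barrier function vanished, xbar_i times the i-th partial
    derivative of f would equal mu rho_i, which lies in (0, eps_g / 4], and the first-order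
    conditions would hold. *)
Lemma lb_g_neq0 : first_order_violated f q x -> lb_g f q x != 0.
Proof.
have /andP[mu0 _] := lb_mu_bounds hq; have /andP[e0 _] := eps_H_bounds hq.
have E0 : 0 < eps_g q by rewrite -(eps_H_sqr hq) exprn_gt0.
move=> viol; apply/eqP => g0; move: viol.
have gi i : xbar x i * grad f x i ord0 = lb_mu q * rho x i.
  by have := lb_gE q x0 fx i; rewrite g0 mxE => /esym/eqP; rewrite subr_eq0 => /eqP.
case=> [[i]|].
  have /andP[b0 _] := xbar_bounds x0 i; have /andP[r0 _] := rho_bounds x0 i.
  have : 0 < xbar x i * grad f x i ord0 by rewrite gi mulr_gt0.
  by rewrite pmulr_rgt0 //; lra.
rewrite ltNge => /negP; apply; apply: norm_leP (ltW E0) _ => i.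
rewrite Dbar_mulE -/(xbar x i) gi; have /andP[r0 r1] := rho_bounds x0 i.
rewrite (gtr0_norm (mulr_gt0 mu0 r0)).
have mE : lb_mu q = eps_g q / 4 by [].
by have := ler_wpM2l (ltW mu0) r1; lra.
Qed.

Lemma ccg_Hbar_sym : (ccg_Hbar (lb_ccg f q x))^T = ccg_Hbar (lb_ccg f q x).
Proof.
by rewrite linearD /= tr_scalar_mx lb_H_sym // (hess_sym LH0 fU oU Ux).
Qed.

Let zr01 : 0 < zeta_r q < 1.
Proof. by have [[]] := hq. Qed.

Let cmu0 : 0 <= zeta_b q * lb_mu q.
Proof.
have [[_ _ _ /andP[z0 _]] _] := hq; have /andP[m0 _] := lb_mu_bounds hq.
by rewrite mulr_ge0 // ltW.
Qed.

Let M00 : 0 <= odflt 0 (Mhat q) + lb_mu q.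
Proof.
have /andP[m0 _] := lb_mu_bounds hq; rewrite addr_ge0 ?(ltW m0) //.
by case e : (Mhat q) => [M|] //=; have [/ltW] := hM e.
Qed.

Let eps0 : 0 < eps_H q.
Proof. by have /andP[] := eps_H_bounds hq. Qed.

Lemma lb_ccg_returns : first_order_violated f q x ->
  exists dh ty, ccg_returns (lb_ccg f q x) dh ty.
Proof.
move=> /lb_g_neq0 g0.
exact: (@ccg_terminates _ _ (lb_ccg f q x) ccg_Hbar_sym g0 eps0 zr01 cmu0 M00).
Qed.

(** The test on the matrix shifted by 2 eps_H gives curvature below -eps_H; it is recorded with
    eps_H / 4, the bound shared with the directions of the oracle. *)
Lemma ccg_nc_curvature (dh : 'cV[R]_n.+1) : ccg_returns (lb_ccg f q x) dh NC ->
  dh != 0 /\ quad (lb_H f q x) dh <= - (eps_H q / 4 * enorm dh ^+ 2).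
Proof.
move=> /ccg_nc_neg_curv; rewrite /neg_curv quadD quad_scalar /= => h.
have d0 : dh != 0.
  apply/eqP => dz; move: h; rewrite dz.
  have -> : enorm (0 : 'cV[R]_n.+1) = 0 by apply/eqP; rewrite enorm_eq0.
  by rewrite /quad mulmx0 dot0r expr0n /= !mulr0 addr0 ltxx.
have k0 : 0 < eps_H q * enorm dh ^+ 2 by rewrite mulr_gt0 // exprn_gt0 // enorm_gt0.
by split => //; lra.
Qed.

(** The oracle sees the Hessian of f only. The barrier adds at most mu = eps_H^2 / 4 <= eps_H / 4 to
    the curvature along a unit vector, so half of -eps_H / 2 survives. *)
Lemma meo_curvature (lam : R) (v : 'cV[R]_n.+1) :
  meo_direction (scaled_hess f x) (eps_H q) lam v ->
  v != 0 /\ quad (lb_H f q x) v <= - (eps_H q / 4 * enorm v ^+ 2).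
Proof.
case=> lam_le v1 vlam; split; first by rewrite -enorm_gt0 v1.
rewrite quad_lb_H // -quad_scaled_hess vlam v1 expr1n mulr1.
have S : \sum_i (rho x i * v i ord0) ^+ 2 <= 1.
  apply: (@le_trans _ _ (enorm v ^+ 2)); last by rewrite v1 expr1n.
  rewrite sqr_enormE; apply: ler_sum => i _; rewrite exprMn.
  have /andP[r0 r1] := rho_bounds x0 i.
  by rewrite ler_piMl ?sqr_ge0 // exprn_ile1 // ltW.
have /andP[m0 _] := lb_mu_bounds hq; have /andP[e0 e1] := eps_H_bounds hq.
have := ler_wpM2l (ltW m0) S; rewrite mulr1 => h.
have : lb_mu q <= eps_H q / 4.
  by rewrite lb_muE // ler_pM2r ?invr_gt0 // expr2 ler_piMl // ltW.
by lra.
Qed.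

Lemma search_progress (o : meo_output R n.+1) (d : 'cV[R]_n.+1) :
  search_direction f q x o d ->
  (forall j (t : R), 0 <= t <= 1 -> U (x + t *: (trial_point q x d j - x))) ->
  [/\ exists j, accepted f q x d j, `|Dratio x *m d| <= beta q &
    forall j, (forall i, (i < j)%N -> ~~ accepted f q x d i) ->
      big_step q LH <= theta q ^+ j * enorm d \/
      (first_order_violated f q x /\
       ~ first_order_violated f q (trial_point q x d j))].
Proof.
have e4 : 0 < eps_H q / 4 by rewrite divr_gt0.
have c0 := c_all_gt0 hq LH0.
(* Common to negative curvature from CCG and from the oracle: the latter returns a unit vector, so
   dividing by the cube of its norm changes nothing. *)
have curv (dh : 'cV[R]_n.+1) (s : R) : dh != 0 ->
    quad (lb_H f q x) dh <= - (eps_H q / 4 * enorm dh ^+ 2) ->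
    is_sgn (dot (lb_g f q x) dh) s ->
    forall d, d = (- s * Num.min (`|quad (lb_H f q x) dh| / enorm dh ^+ 3)
                          (beta q / `|Dratio x *m dh|)) *: dh ->
    (forall j (t : R), 0 <= t <= 1 -> U (x + t *: (trial_point q x d j - x))) ->
    [/\ exists j, accepted f q x d j, `|Dratio x *m d| <= beta q &
    forall j, (forall i, (i < j)%N -> ~~ accepted f q x d i) ->
      big_step q LH <= theta q ^+ j * enorm d \/
      (first_order_violated f q x /\
       ~ first_order_violated f q (trial_point q x d j))].
  move=> dh0 Hdh sg d' ->.
  have [d0 db gd Hd dn] := curvature_direction hq x0 dh0 Hdh sg.
  move=> seg; split => //.
    exact: (curvature_search hq LH0 fU x0 seg db d0 gd Hd).
  move=> j rej; left.
  have cl := curvature_step_length hq LH0 fU x0 seg db d0 gd Hd rej.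
  apply: (@le_trans _ _ (c_all q LH * (eps_H q / 4))).
    by rewrite /big_step mulrA.
  by apply: ler_pM => //; exact: ltW.
move=> sd; case: sd => {o d} [oo dh s viol ret sg|oo dh viol ret|lam v s nviol md sg].
- have [dh0 Hdh] := ccg_nc_curvature ret.
  exact: (curv _ _ dh0 Hdh sg).
- have [dh0 Qdh rdh rc] := @ccg_solP _ _ (lb_ccg f q x) ccg_Hbar_sym
    (lb_g_neq0 viol) eps0 zr01 cmu0 M00 dh ret.
  have [d0 db model dcase] := newton_direction hq x0 dh0 Qdh rdh.
  set d := _ *: dh in d0 db model dcase * => seg.
  split => //.
    exact: (newton_search hq LH0 fU x0 seg db d0 model).
  case=> [_|j rej]; last first.
    by left; apply: (newton_step_length hq LH0 fU x0 seg db d0 model).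
  (* A full step can be short only when the truncation was inactive, and then the residual test of
     CCG speaks about d itself. *)
  rewrite expr0 mul1r; case: dcase => [ddh|dbig]; last first.
    left; apply: le_trans dbig; have [_ _ c1 _] := c_all_le hq LH0.
    by rewrite /big_step; have := ler_wpM2r (ltW eps0) c1; have := mulr_gt0 c0 eps0; lra.
  have [big|small] := leP (big_step q LH) (enorm d); first by left.
  right; split => //; rewrite /trial_point expr0 scale1r.
  have seg0 (t : R) : 0 <= t <= 1 -> U (x + t *: (Dbar x *m d)).
    move=> ht; have := seg 0%N t ht; rewrite /trial_point expr0 scale1r.
    by have -> : x + Dbar x *m d - x = Dbar x *m d by rewrite addrAC subrr add0r.
  apply: (small_newton_step hq LH0 fU x0 seg0) small.
  by rewrite ddh.
- have [v0 Hv] := meo_curvature md; have [_ v1 _] := md.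
  rewrite dotC in sg.
  by apply: (curv _ _ v0 Hv sg); rewrite v1 expr1n divr1.
Qed.

(** Both ways into [Stuck] are excluded, since CCG returns and the line search ends. The number s is
    alpha |d|, which dominates the displacement because Xbar does not lengthen vectors. *)
Lemma step_progress (o : meo_output R n.+1) (d : 'cV[R]_n.+1)
    (s' : lbncg_state R n.+1) :
  lbncg_step f q (Running x) o d s' ->
  (search_direction f q x o d ->
   forall j (t : R), 0 <= t <= 1 -> U (x + t *: (trial_point q x d j - x))) ->
  [/\ s' = Terminated x, o = Certificate & ~ first_order_violated f q x] \/
  exists x' s, [/\ s' = Running x', forall i, 0 < x' i ord0,
    enorm (x' - x) <= s, lb_phi f q x' < lb_phi f q x - eta q / 6 * s ^+ 3 &
    big_step q LH <= s \/
    (first_order_violated f q x /\ ~ first_order_violated f q x')].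
Proof.
move=> st seg; inversion st as [y e o' j sd acc rej|y e o' sd nacc|y e o' viol nret|y e nviol| |];
  subst; last 1 first.
- by left.
- have [_ db prog] := search_progress sd (seg sd).
  right; exists (trial_point q x d j), (theta q ^+ j * enorm d).
  have /andP[a0 a1] := theta_pow_bounds hq j.
  have /andP[_ b1] := beta_bounds hq.
  split => //.
  + have a01 : 0 <= theta q ^+ j <= 1 by rewrite a1 ltW.
    by move=> i; exact: (pos_step x0 i a01 b1 db).
  + have -> : trial_point q x d j - x = theta q ^+ j *: (Dbar x *m d).
      by rewrite /trial_point addrAC subrr add0r.
    by rewrite enormZ gtr0_norm // ler_wpM2l ?(ltW a0) // enorm_Dbar_le.
  + by move: acc; rewrite /accepted -[_ * _ ^+ 3 * enorm d ^+ 3]mulrA -exprMn.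
  + exact: prog.
- have [[j acc] _ _] := search_progress sd (seg sd).
  by move: (nacc j); rewrite acc.
- have [dh [ty ret]] := lb_ccg_returns viol.
  by case: (nret dh ty).
Qed.

End Iteration.

(** * Iteration count *)

(** The displacement takes back e s^2 T / 12 out of e s^2 T / 6; B s <= T then turns the remaining
    length into a count. *)
Lemma step_count_bound (R : realType) (e s T B Q : R) :
  e / 6 * s ^+ 2 * T < Q + e * s ^+ 2 / 24 * (2 * T + s) ->
  e * s ^+ 2 * (B * s) <= e * s ^+ 2 * T ->
  e * s ^+ 3 * B < 12 * Q + e * s ^+ 3 / 2.
Proof. by move=> h1 h2; lra. Qed.

Section DeterministicRun.
Variables (R : realType) (n : nat) (f : 'cV[R]_n.+1 -> R) (q : lbncg_params R).
Variables (U : set 'cV[R]_n.+1) (Lg LH flow : R) (x0 : 'cV[R]_n.+1).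
Variables (s : nat -> lbncg_state R n.+1) (o : nat -> meo_output R n.+1).
Variable (d : nat -> 'cV[R]_n.+1).
Hypothesis hq : params_ok q.
Hypothesis hM : Mhat_ok f q.
Hypothesis LH0 : 0 < LH.
Hypothesis oU : open U.
Hypothesis fU : twice_lipschitz_on f U Lg LH.
Hypothesis flow_le : assumption2 f flow.
Hypothesis x00 : forall i, 0 < x0 i ord0.
Hypothesis s0 : s 0%N = Running x0.
Hypothesis sS : forall k, lbncg_step f q (s k) (o k) (d k) (s k.+1).
Hypothesis path : forall k x, s k = Running x ->
  U x /\ (search_direction f q x (o k) (d k) ->
    forall j t, 0 <= t <= 1 -> U (x + t *: (trial_point q x (d k) j - x))).

Local Notation sigma := (big_step q LH).
Local Notation N := (n.+1%:R : R).

Lemma big_step_gt0 : 0 < sigma.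
Proof.
have /andP[e0 _] := eps_H_bounds hq.
by rewrite divr_gt0 // mulr_gt0 // c_all_gt0.
Qed.

(* Among k moves, B are of length at least sigma and of total length at most T;
   S bounds the length of all, and pend holds when the last one was short. *)
Definition progress k (x : 'cV[R]_n.+1) := exists (B : nat) (T S : R) (pend : bool),
  [/\ (k <= B.*2 + pend)%N, B%:R * sigma <= T, S <= 2 * T + pend%:R * sigma &
   [/\ lb_phi f q x <= lb_phi f q x0 - eta q / 6 * sigma ^+ 2 * T,
       (0 < k)%N -> lb_phi f q x < lb_phi f q x0 - eta q / 6 * sigma ^+ 2 * T,
       \sum_i (x i ord0 - x0 i ord0) <= Num.sqrt N * S &
       pend -> ~ first_order_violated f q x]].

Lemma sum_le_sqrt (u : 'cV[R]_n.+1) : \sum_i u i ord0 <= Num.sqrt N * enorm u.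
Proof.
have -> : \sum_i u i ord0 = dot (const_mx 1) u.
  by rewrite dotE; apply: eq_bigr => i _; rewrite mxE mul1r.
apply: le_trans (dot_le_enorm _ _) _.
suff -> : enorm (const_mx 1 : 'cV[R]_n.+1) = Num.sqrt N by [].
rewrite -[LHS]ger0_norm ?enorm_ge0 // -sqrtr_sqr sqr_enormE; congr Num.sqrt.
rewrite (eq_bigr (fun=> 1)) ?sumr_const ?card_ord // => i _.
by rewrite mxE expr1n.
Qed.

Lemma progress_step k (x x' : 'cV[R]_n.+1) (l : R) : progress k x ->
  enorm (x' - x) <= l -> lb_phi f q x' < lb_phi f q x - eta q / 6 * l ^+ 3 ->
  sigma <= l \/ (first_order_violated f q x /\ ~ first_order_violated f q x') ->
  progress k.+1 x'.
Proof.
have sg0 := big_step_gt0; have [_ [_ /andP[eta0 _]]] := hq.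
move=> [B [T [S [pend [kB BT ST [phi _ disp pviol]]]]]] len dec step.
have l0 : 0 <= l := le_trans (enorm_ge0 _) len.
have disp' : \sum_i (x' i ord0 - x0 i ord0) <= Num.sqrt N * (S + l).
  rewrite mulrDr; apply: le_trans (lerD disp (ler_wpM2l (sqrtr_ge0 _) len)).
  apply: le_trans (lerD (lexx _) (sum_le_sqrt (x' - x))).
  rewrite -big_split /= le_eqVlt; apply/orP; left; apply/eqP; apply: eq_bigr => i _.
  by rewrite mxE_sub; ring.
have eta6 : 0 <= eta q / 6 by rewrite divr_ge0 // ltW.
have [big|small] := leP sigma l.
  exists B.+1, (T + l), (S + l), false; split.
  - by rewrite addn0 doubleS !ltnS (leq_trans kB) // -addn1 leq_add2l leq_b1.
  - by rewrite -addn1 natrD mulrDl mul1r lerD.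
  (* A pending short step added at most sigma to S; since sigma <= l it is charged to the new step,
     which is what the factor 2 in front of T pays for. *)
  - rewrite mul0r addr0; case: (pend) ST => ST.
      by rewrite mul1r in ST; lra.
    by rewrite mul0r in ST; lra.
  have l3 : eta q / 6 * (sigma ^+ 2 * l) <= eta q / 6 * l ^+ 3.
    by rewrite ler_wpM2l // (exprSr l 2) ler_wpM2r // ler_pXn2r // nnegrE ltW.
  have lt : lb_phi f q x' < lb_phi f q x0 - eta q / 6 * sigma ^+ 2 * (T + l).
    apply: lt_le_trans dec _; rewrite mulrDr -[_ * _ * l]mulrA opprD addrA.
    exact: lerB.
  by split => //; exact: ltW.
case: step => [big|[viol nviol]]; first by move: small; rewrite ltNge big.
have pF : pend = false by apply/negP => /pviol; apply.
have {viol nviol pviol} pviol' : true -> ~ first_order_violated f q x' by [].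
exists B, T, (S + l), true; split => //.
- by rewrite addn1 ltnS (leq_trans kB) // pF addn0.
- by move: ST; rewrite pF mul0r mul1r; lra.
have l3 : 0 <= eta q / 6 * l ^+ 3 by rewrite mulr_ge0 // exprn_ge0.
have lt : lb_phi f q x' < lb_phi f q x0 - eta q / 6 * sigma ^+ 2 * T.
  apply: lt_le_trans dec _; apply: le_trans phi; rewrite gerBl.
  exact: l3.
by split => //; exact: ltW.
Qed.

Lemma progress0 : progress 0 x0.
Proof.
exists 0%N, 0, 0, false; rewrite !mul0r !mulr0 addr0 subr0; split => //; split => //.
by rewrite big1 // => i _; rewrite subrr.
Qed.

Lemma run_invariant k :
  (exists2 x, s k = Running x & (forall i, 0 < x i ord0) /\ progress k x) \/
  (exists m x, [/\ (m < k)%N, s k = Terminated x, s m = Running x,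
    o m = Certificate & (forall i, 0 < x i ord0) /\ ~ first_order_violated f q x]).
Proof.
elim: k => [|k [[x sk [xp px]]|[m [x [mk sk sm om fo]]]]].
- by left; exists x0 => //; split => //; exact: progress0.
- have [Ux seg] := path sk; have := sS k; rewrite sk => st.
  have [[sk1 ok nviol]|[x' [l [sk1 xp' len dec step]]]] :=
      step_progress hq hM LH0 oU fU Ux xp st seg.
    by right; exists k, x; split.
  left; exists x'; first exact: sk1.
  split; first exact: xp'.
  exact: progress_step px len dec step.
- right; exists m, x; split => //; first exact: ltnW.
  by have := sS k; rewrite sk => st; inversion st.
Qed.

Lemma ln_le_affine (t w : R) : 0 < t -> 0 < w -> ln t <= ln w + (t / w - 1).
Proof.
move=> t0 w0; have tw : 0 < t / w by rewrite divr_gt0.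
have -> : ln t = ln w + ln (t / w) by rewrite ln_div ?posrE // addrC subrK.
rewrite lerD2l.
have -> : ln (t / w) = ln (1 + (t / w - 1)) by rewrite addrC subrK.
by apply: le_ln1Dx; lra.
Qed.

Local Notation w2 := (omega2 (eta q) (c_all q LH) n.+1 `|x0|).

Lemma omega2_bounds : [/\ 0 < w2, `|x0| <= w2 &
  Num.sqrt N / w2 <= eta q * c_all q LH ^+ 2 / 96].
Proof.
have [_ [_ /andP[eta0 _]]] := hq; have c0 := c_all_gt0 hq LH0.
have N0 : 0 < Num.sqrt N by rewrite sqrtr_gt0.
have k0 : 0 < eta q * c_all q LH ^+ 2 by rewrite mulr_gt0 // exprn_gt0.
have w1 : 96 * Num.sqrt N / (eta q * c_all q LH ^+ 2) <= w2 by rewrite le_max lexx.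
have w0 : 0 < w2 by apply: lt_le_trans w1; rewrite divr_gt0 // mulr_gt0.
split => //; first by rewrite le_max lexx orbT.
rewrite ler_pdivrMr // mulrAC ler_pdivlMr // mulrC.
by move: w1; rewrite ler_pdivrMr // mulrC [X in _ <= X]mulrC.
Qed.

(** Since x0_i <= omega_2, the -1 in the tangent bound for ln x_i can be weakened to -x0_i /
    omega_2, so that only the displacement from x0 appears. This is the reason for the entry
    ||x^0||_oo in omega_2. *)
Lemma barrier_gap (x : 'cV[R]_n.+1) (S : R) : (forall i, 0 < x i ord0) ->
  \sum_i (x i ord0 - x0 i ord0) <= Num.sqrt N * S ->
  \sum_i ln (x i ord0) - \sum_i ln (x0 i ord0) <=
    N * (ln w2 - min_log x0) + Num.sqrt N / w2 * S.
Proof.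
move=> xp disp; have [w0 xw _] := omega2_bounds.
have h1 : \sum_i ln (x i ord0) <= \sum_i (ln w2 + (x i ord0 - x0 i ord0) / w2).
  apply: ler_sum => i _; apply: le_trans (ln_le_affine (xp i) w0) _.
  rewrite lerD2l mulrBl lerD2l lerN2 ler_pdivrMr // mul1r.
  by apply: le_trans xw; apply: le_trans (coord_le_norm _ i); exact: ler_norm.
have h2 : \sum_(i < n.+1) min_log x0 <= \sum_i ln (x0 i ord0).
  by apply: ler_sum => i _; exact: bigmin_le.
rewrite sumr_const card_ord -[_ *+ _]mulr_natl in h2.
rewrite big_split /= sumr_const card_ord -[_ *+ _]mulr_natl -mulr_suml in h1.
have h3 : (\sum_i (x i ord0 - x0 i ord0)) / w2 <= Num.sqrt N / w2 * S.
  by rewrite mulrAC ler_wpM2r // invr_ge0 ltW.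
by lra.
Qed.

Local Notation A := (1536 * (f x0 - flow + lb_mu q * N * (ln w2 - min_log x0))
  / (eta q * c_all q LH ^+ 3 * eps_H q ^+ 3)).

(** Strictness matters, because [K2bar] may equal this bound exactly; it comes from the strict
    decrease of accepted steps, hence k > 0. *)
Lemma running_bound k x : (0 < k)%N -> s k = Running x -> k%:R < A + 2.
Proof.
move=> k0 sk; have [[y sk' [yp [B [T [S [pend [kB BT ST [_ phi disp _]]]]]]]]|[m [y [_ sk']]]] :=
  run_invariant k; last by rewrite sk in sk'.
have {}phi := phi k0; have sg0 := big_step_gt0.
have [_ [_ /andP[eta0 _]]] := hq; have c0 := c_all_gt0 hq LH0.
have /andP[e0 _] := eps_H_bounds hq; have /andP[mu0 _] := lb_mu_bounds hq.
have [w0 _ wb] := omega2_bounds.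
have gap := barrier_gap yp disp.
set L := ln w2 - min_log x0 in gap *.
have T0 : 0 <= T by apply: le_trans BT; rewrite mulr_ge0 // ltW.
set V := 2 * T + sigma.
have SV : S <= V by apply: le_trans ST _; rewrite lerD2l ler_piMl ?(ltW sg0) // lern1 leq_b1.
have V0 : 0 <= V by rewrite /V addr_ge0 ?mulr_ge0 // ltW.
have h1 : Num.sqrt N / w2 * S <= eta q * c_all q LH ^+ 2 / 96 * V.
  apply: (@le_trans _ _ (Num.sqrt N / w2 * V)); last by rewrite ler_wpM2r.
  by rewrite ler_wpM2l // divr_ge0 ?sqrtr_ge0 // ltW.
have h2 := ler_wpM2l (ltW mu0) (le_trans gap (lerD (lexx _) h1)).
have fl := flow_le y.
have h3 : eta q / 6 * sigma ^+ 2 * T < f x0 - flow + lb_mu q * N * L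
    + lb_mu q * (eta q * c_all q LH ^+ 2 / 96 * V).
  move: phi h2; rewrite /lb_phi /barrier.
  move: (f y) fl (f x0) (\sum_i ln _) (\sum_i ln _) (_ / 6 * _ * T) (_ / 96 * V).
  by move=> *; lra.
set Q := f x0 - flow + _ in h3 *.
have e1 : lb_mu q * (eta q * c_all q LH ^+ 2 / 96 * V) = eta q * sigma ^+ 2 / 24 * V.
  rewrite (lb_muE hq) /big_step.
  by move: (eta q) (c_all q LH) (eps_H q) => a b c; move: V {SV V0 h1 h2 h3} => v; field.
rewrite {}e1 in h3.
have h4 : eta q * sigma ^+ 2 * (B%:R * sigma) <= eta q * sigma ^+ 2 * T.
  by rewrite ler_wpM2l // mulr_ge0 ?sqr_ge0 // ltW.
have h5 : eta q * sigma ^+ 3 * B%:R < 12 * Q + eta q * sigma ^+ 3 / 2.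
  exact: step_count_bound h3 h4.
have K0 : 0 < eta q * sigma ^+ 3 by rewrite mulr_gt0 // exprn_gt0.
have kB' : (k%:R : R) <= 2 * B%:R + 1.
  have : (k <= B.*2.+1)%N by rewrite (leq_trans kB) // -addn1 leq_add2l leq_b1.
  by rewrite -(ler_nat R) -addn1 -mul2n natrD natrM.
have AE : 1536 * Q / (eta q * c_all q LH ^+ 3 * eps_H q ^+ 3)
    = 24 * Q / (eta q * sigma ^+ 3).
  rewrite /big_step; move: (eta q) (c_all q LH) (eps_H q) eta0 c0 e0 Q {h3 h5}.
  move=> a b c a0 b0 c0' Q.
  by field; rewrite !gt_eqF.
rewrite AE; apply: le_lt_trans kB' _.
have : B%:R < 12 * Q / (eta q * sigma ^+ 3) + 1 / 2.
  rewrite -(ltr_pM2l K0); apply: lt_le_trans h5 _.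
  have -> (u v : R) : 0 < u -> u * (v / u + 1 / 2) = v + u / 2 => // u0.
  by field; rewrite gt_eqF.
rewrite -[24 * Q / _]mulrA -[12 * Q / _]mulrA.
by move: (Q / _) (B%:R : R) => u v; lra.
Qed.

Lemma epsH_power : eps_g q `^ (- (3 / 2)) = (eps_H q ^+ 3)^-1.
Proof.
have /andP[e0 _] := eps_H_bounds hq.
have -> : - (3 / 2) = 1 / 2 * (- 3%:R) :> R by field.
by rewrite powRrM powR_invn // ltW.
Qed.

Lemma run_terminates : exists m x, [/\
  (m < K2bar (eta q) (c_all q LH) (f x0 - flow) `|x0| (min_log x0) n.+1 (eps_g q))%N,
  s (K2bar (eta q) (c_all q LH) (f x0 - flow) `|x0| (min_log x0) n.+1 (eps_g q))
    = Terminated x, s m = Running x, o m = Certificate &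
  (forall i, 0 < x i ord0) /\ ~ first_order_violated f q x].
Proof.
set K := K2bar _ _ _ _ _ _ _.
have [[x sK _]|//] := run_invariant K; exfalso.
have K0 : (0 < K)%N by rewrite /K /K2bar addn2.
have := running_bound K0 sK; rewrite ltNge => /negP; apply.
rewrite /K /K2bar natrD lerD2r epsH_power.
set X := (X in Num.ceil X); set Y := (Y in Y <= _).
have -> : Y = X by rewrite /Y /X /lb_mu invfM mulrA.
apply: le_trans (ceil_ge X) _; rewrite -[leRHS]/((Posz `|Num.ceil X|%N)%:~R).
by rewrite ler_int; exact: lez_abs.
Qed.

(** Certificates are final: together with absorption of [Terminated] this identifies the certified
    point with the one at which the run ends. *)
Lemma certified_terminated m k x : s m = Running x -> o m = Certificate ->
  ~ first_order_violated f q x -> (m < k)%N -> s k = Terminated x.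
Proof.
move=> sm om nv; elim: k => // k IH; rewrite ltnS leq_eqVlt => /predU1P[<-|mk].
  have [Ux seg] := path sm; have := sS m; rewrite sm om => st.
  inversion st as [y e o' j sd acc rej|y e o' sd nacc|y e o' viol nret|y e nviol| |]; subst => //.
  - by inversion sd.
  - by inversion sd.
by have := sS k; rewrite (IH mk) => st; inversion st.
Qed.

End DeterministicRun.

(** * Probability of a correct stop *)

Section Filtration.
Variables (T : Type) (G : set (set T)).
Hypothesis sG : sigma_algebra setT G.

Lemma sigma_algebra_setC (A : set T) : G A -> G (~` A).
Proof. by have [_ h _] := sG => /h; rewrite setTD. Qed.

Lemma sigma_algebra_setI (A B : set T) : G A -> G B -> G (A `&` B).
Proof.
move=> /sigma_algebra_setC GA /sigma_algebra_setC GB.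
rewrite -[A `&` B]setCK setCI; apply: sigma_algebra_setC.
have [G0 _ GU] := sG; rewrite -bigcup2E; apply: GU => -[|[|i]] //=.
Qed.

Lemma sigma_algebra_setD (A B : set T) : G A -> G B -> G (A `\` B).
Proof.
by move=> GA GB; rewrite setDE; apply: sigma_algebra_setI => //; exact: sigma_algebra_setC.
Qed.

End Filtration.

Definition no_failure (T : Type) (called right : nat -> set T) (k : nat) : set T :=
  [set w | forall j, (j < k)%N -> ~ (called j `\` right j) w].

Lemma no_failure0 (T : Type) (called right : nat -> set T) :
  no_failure called right 0 = setT.
Proof. by apply/seteqP; split => // w _ j; rewrite ltn0. Qed.

Lemma no_failureS (T : Type) (called right : nat -> set T) k :
  no_failure called right k.+1
  = no_failure called right k `\` (called k `\` right k).
Proof.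
apply/seteqP; split => w /=.
  by move=> h; split=> [j jk|]; apply: h; rewrite ltnS // ltnW.
by move=> [h nk] j; rewrite ltnS leq_eqVlt => /predU1P[->|/h].
Qed.

Section NoFailure.
Variables (R : realType) (disp : measure_display) (Omega : measurableType disp).
Variables (P : probability Omega R) (F : nat -> set (set Omega)).
Variables (called right fast : nat -> set Omega) (delta : R).
Hypothesis delta01 : 0 <= delta < 1.
Hypothesis sF : forall k, sigma_algebra setT (F k).
Hypothesis mF : forall k, F k `<=` measurable.
Hypothesis F_mono : forall k, F k `<=` F k.+1.
Hypothesis F_called : forall k, F k (called k).
Hypothesis F_right : forall k, F k.+1 (right k).
Hypothesis m_fast : forall k, measurable (fast k).
Hypothesis reliable : forall k (A : set Omega), F k A -> A `<=` called k ->
  ((1 - delta)%:E * P A <= P (A `&` right k `&` fast k))%E.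

Local Notation no_failure := (no_failure called right).

Lemma F_no_failure k : F k (no_failure k).
Proof.
elim: k => [|k IH].
  rewrite no_failure0 -setC0.
  by apply: sigma_algebra_setC => //; have [] := sF 0%N.
rewrite no_failureS; apply: (sigma_algebra_setD (sF _)); first exact: F_mono.
by apply: (sigma_algebra_setD (sF _)) => //; exact: F_mono.
Qed.

(** The event is split by whether the oracle is called at k. Outside the calls no probability is
    lost; on the calls the conditional bound applies, because a clean past intersected with the call
    belongs to F k. *)
Lemma no_failure_ge k : (((1 - delta) ^+ k)%:E <= P (no_failure k))%E.
Proof.
have /andP[d0 d1] := delta01.
elim: k => [|k IH].
  by rewrite no_failure0 probability_setT expr0.
have mE j : measurable (no_failure j) by apply: mF; exact: F_no_failure.
have mC : measurable (called k) by apply: mF.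
have mR : measurable (right k) by apply: (mF (k := k.+1)).
rewrite exprS EFinM; apply: (@le_trans _ _ ((1 - delta)%:E * P (no_failure k))%E).
  by rewrite lee_wpmul2l // lee_fin subr_ge0 ltW.
have mA : measurable (no_failure k `&` called k) by exact: measurableI.
have mD : measurable (no_failure k `\` called k) by exact: measurableD.
have E1 : (P (no_failure k) = P (no_failure k `\` called k)
    + P (no_failure k `&` called k))%E by rewrite -measureDI.
have E2 : (P (no_failure k.+1) = P (no_failure k.+1 `\` called k)
    + P (no_failure k.+1 `&` called k))%E by rewrite -measureDI.
rewrite E1 E2 muleDr //; last by rewrite ge0_adde_def // inE measure_ge0.
have -> : no_failure k.+1 `\` called k = no_failure k `\` called k.
  rewrite no_failureS; apply/seteqP; split => w /=.
    by move=> [[h _] nc].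
  by move=> [h nc]; split => //; split => // -[].
have -> : no_failure k.+1 `&` called k = no_failure k `&` called k `&` right k.
  rewrite no_failureS; apply/seteqP; split => w /=.
    by move=> [[h nb] c]; split => //; apply: contrapT => nr; apply: nb.
  by move=> [[h c] rt]; split => //; split => // -[].
apply: leeD.
  rewrite -[leRHS]mul1e lee_wpmul2r ?measure_ge0 // lee_fin; lra.
apply: le_trans (reliable _ _) _.
- by apply: sigma_algebra_setI => //; exact: F_no_failure.
- by move=> w [].
- apply: le_measure; rewrite ?inE; [|exact: measurableI|by move=> w []].
  by apply: measurableI => //; exact: measurableI.
Qed.

End NoFailure.

(** * Growth of the iteration bound *)

Lemma tildeO_K2bar (R : realType) (eta call gap xmax lmin : R) :
  0 < eta -> 0 < call -> 0 <= xmax ->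
  tildeO (fun m eps => (K2bar eta call gap xmax lmin m eps)%:R)
    (fun m eps => m%:R * eps `^ (- (1 / 2)) + eps `^ (- (3 / 2))).
Proof.
move=> eta0 c0 x0.
set a := 96 / (eta * call ^+ 2).
have a0 : 0 < a by rewrite divr_gt0 // mulr_gt0 // exprn_gt0.
set c1 := `|ln a| + `|ln (a + xmax)| + 1.
set D := 1536 / (eta * call ^+ 3).
have k0 : 0 < eta * call ^+ 3 by rewrite mulr_gt0 // exprn_gt0.
have D0 : 0 < D by apply: divr_gt0; [rewrite ltr0n | exact: k0].
(* The 3 pays for the rounding and for the added 2, since the logarithmic factor times the target is
   at least 1; a single power of the logarithm is enough. *)
exists (D * (`|gap| + c1 + `|lmin|) + 3), 1%N => m eps m0 /andP[e0 e1].
rewrite expr1; set L := 1 + _ + _.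
set p := eps `^ (- (3 / 2)); set p' := eps `^ (- (1 / 2)).
have m1 : 1 <= m%:R :> R by rewrite ler1n.
have lnm : 0 <= ln m%:R :> R by rewrite ln_ge0.
have lne : 0 <= ln eps^-1 by rewrite ln_ge0 // invf_ge1 // ltW.
have L1 : 1 <= L by rewrite /L; lra.
have p1 : 1 <= p.
  rewrite /p powRN invf_ge1 ?powR_gt0 //; rewrite -[leRHS](powRr0 eps).
  by apply: ger_powR; rewrite ?e0 ?(ltW e1) ?divr_ge0.
have p'0 : 0 <= p' by apply: powR_ge0.
(* The factor mu, proportional to eps, lowers the exponent of the barrier term and so produces n
   eps^(-1/2). *)
have pp : eps * p = p'.
  rewrite /p /p' -{1}(powRr1 (ltW e0)) -powRD; last by rewrite (gt_eqF e0) implybT.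
  by congr (_ `^ _); field.
have sm : 1 <= Num.sqrt (m%:R : R) by rewrite -[leLHS](sqrtr1 R) ler_wsqrtr.
set w := omega2 eta call m xmax.
(* omega_2 lies between a constant and a constant times n, so its logarithm is absorbed by the term
   ln n of L. *)
have wE : w = Num.max (a * Num.sqrt m%:R) xmax by rewrite /w /omega2 /a mulrAC.
have w_lo : a <= w by rewrite wE le_max ler_pMr // sm.
have w_hi : w <= (a + xmax) * m%:R.
  have smm : Num.sqrt (m%:R : R) <= m%:R.
    rewrite -{2}(@sqr_sqrtr _ m%:R) // expr2 ler_peMl //; lra.
  rewrite wE ge_max; apply/andP; split; nra.
have ax0 : 0 < a + xmax by lra.
have m00 : 0 < m%:R :> R by lra.
have w0 : 0 < w by lra.
have lnw : `|ln w| <= c1 * L.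
  have h1 : ln a <= ln w by rewrite ler_ln ?posrE.
  have h2 : ln w <= ln (a + xmax) + ln m%:R.
    by rewrite -lnM ?posrE // ler_ln ?posrE // mulr_gt0.
  have := ler_norm (ln (a + xmax)); have := ler_norm (- ln a); rewrite normrN => h3 h4.
  have h5 : `|ln w| <= `|ln a| + `|ln (a + xmax)| + ln m%:R.
    have := normr_ge0 (ln a); have := normr_ge0 (ln (a + xmax)).
    by move=> *; rewrite ler_norml; apply/andP; split; lra.
  apply: le_trans h5 _; rewrite /c1 mulrDl mul1r; apply: lerD.
    by rewrite ler_peMr // addr_ge0.
  by rewrite /L; lra.
rewrite /K2bar natrD; set X := (X in Num.ceil X).
have cX : (`|Num.ceil X|%N%:R : R) <= `|X| + 1.
  have -> : (`|Num.ceil X|%N%:R : R) = `|(Num.ceil X)%:~R|.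
    by rewrite -intr_norm -abszE.
  have := ceil_ge X; have := ceilB1_lt X; have := ler_norm X; have := ler_norm (- X).
  rewrite normrN rmorphB /= => h1 h2 h3 h4.
  by rewrite ler_norml; apply/andP; split; lra.
have XE : `|X| <= D * (`|gap| * p + m%:R * p' * (c1 * L + `|lmin|)).
  have -> : X = D * (gap * p + (eps * p) / 4 * m%:R * (ln w - lmin)).
    rewrite /X /D -/w -/p; have : eta * call ^+ 3 != 0.
      by rewrite gt_eqF // mulr_gt0 // exprn_gt0.
    by move: (eta * _) => u u0; field.
  rewrite pp normrM gtr0_norm // ler_wpM2l ?(ltW D0) //.
  apply: le_trans (ler_normD _ _) _; rewrite !normrM.
  have pE : `|p| = p by rewrite ger0_norm //; lra.
  rewrite pE lerD2l (ger0_norm p'0) (ger0_norm (ltW m00)).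
  have q0 : 0 <= p' * m%:R by rewrite mulr_ge0 // ltW.
  have h := le_trans (ler_normB (ln w) lmin) (lerD lnw (lexx _)).
  have h' := ler_wpM2l q0 h.
  have : `|4^-1| = 4^-1 :> R by rewrite ger0_norm.
  move=> ->.
  have h0 : 0 <= p' * m%:R * `|ln w - lmin| by rewrite mulr_ge0.
  lra.
have B0 : 0 <= m%:R * p' by rewrite mulr_ge0 // ltW.
set B := m%:R * p' + p.
have BL : 1 <= L * B.
  by apply: mulr_ege1 => //; rewrite /B; lra.
have LB0 : 0 <= L * B by lra.
have gp : `|gap| * p <= `|gap| * (L * B).
  rewrite ler_wpM2l //; apply: (@le_trans _ _ (1 * B)); first by rewrite /B; lra.
  by rewrite ler_wpM2r // /B; lra.
have c10 : 0 <= c1 by rewrite /c1 !addr_ge0.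
have mp : m%:R * p' * (c1 * L + `|lmin|) <= (c1 + `|lmin|) * (L * B).
  have h : c1 * L + `|lmin| <= (c1 + `|lmin|) * L.
    by rewrite [leRHS]mulrDl lerD2l ler_peMr.
  have hB : m%:R * p' <= B by rewrite /B; lra.
  apply: (@le_trans _ _ (B * ((c1 + `|lmin|) * L))); last by rewrite mulrC mulrA.
  apply: ler_pM => //; rewrite addr_ge0 // mulr_ge0 //; lra.
have := le_trans XE (ler_wpM2l (ltW D0) (lerD gp mp)).
move: cX BL; rewrite -[_ * L * B]mulrA.
by move: (L * B) `|X| (`|Num.ceil X|%N%:R : R) => u v N hX hN hu; lra.
Qed.

(** * Stopping events and the final statement *)

Lemma first_order_point_of_not_violated (R : realType) (n : nat)
    (f : 'cV[R]_n -> R) (q : lbncg_params R) (x : 'cV[R]_n) :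
  (forall i, 0 < x i ord0) -> ~ first_order_violated f q x ->
  first_order_point f q x.
Proof.
move=> x0 nv; split=> // [i|].
  rewrite leNgt; apply/negP => h; apply: nv; left; exists i; exact: ltW.
by rewrite leNgt; apply/negP => h; apply: nv; right.
Qed.

Lemma direction_meo_correct (R : realType) (n : nat) (f : 'cV[R]_n -> R)
    (q : lbncg_params R) (x : 'cV[R]_n) (lam : R) (v d : 'cV[R]_n)
    (s' : lbncg_state R n) :
  lbncg_step f q (Running x) (Direction lam v) d s' ->
  ~ first_order_violated f q x ->
  meo_direction (scaled_hess f x) (eps_H q) lam v.
Proof.
move=> st nv.
have sdP : search_direction f q x (Direction lam v) d ->
    meo_direction (scaled_hess f x) (eps_H q) lam v.
  by move=> sd; inversion sd; subst.
by inversion st; subst; apply: sdP.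
Qed.

Section StoppingEvents.
Variables (R : realType) (n : nat) (f : 'cV[R]_n.+1 -> R) (q : lbncg_params R).
Variables (x0 : 'cV[R]_n.+1) (Lg LH flow : R) (Omega : Type).
Variable (r : lbncg_process R n.+1 Omega).
Hypothesis hq : params_ok q.
Hypothesis hM : Mhat_ok f q.
Hypothesis hx0 : forall i, 0 < x0 i ord0.
Hypothesis hrun : lbncg_run f q x0 r.
Hypothesis LH0 : 0 < LH.
Hypothesis h1 : assumption1 f q r Lg LH.
Hypothesis h2 : assumption2 f flow.

Local Notation K := (K2bar (eta q) (c_all q LH) (f x0 - flow) `|x0|
  (min_log x0) n.+1 (eps_g q)).

Lemma run_outcome w : exists m x, [/\ (m < K)%N, st r K w = Terminated x,
  st r m w = Running x, out r m w = Certificate &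
  first_order_point f q x /\ ~ first_order_violated f q x].
Proof.
have [s0 sS] := hrun w; have [U [oU fU path]] := h1 w.
have [m [x [mK sK sm om [xp nv]]]] := run_terminates hq hM LH0 oU fU h2 hx0 s0 sS path.
exists m, x; split; [exact: mK|exact: sK|exact: sm|exact: om|split; last exact: nv].
exact: first_order_point_of_not_violated.
Qed.

(** A direction used by a step is a true one by construction, so only a certificate can be wrong;
    and as a certificate ends the run, a wrong one can only be issued at the final point. *)
Lemma stops_correctlyE :
  stops_correctly f q r K = no_failure (meo_called f q r) (meo_right f q r) K.
Proof.
apply/seteqP; split => w.
- case=> x [sK _ so] j jK [[y [sj nv]] nright]; apply: nright.
  exists y; split; [exact: sj | exact: nv | ].
  have [s0 sS] := hrun w; have [U [oU fU path]] := h1 w.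
  case oj : (out r j w) => [|lam v].
    have := certified_terminated sS path sj oj nv jK.
    by rewrite sK => -[<-].
  by have := sS j; rewrite sj oj => st; exact: direction_meo_correct st nv.
- move=> ok; have [m [x [mK sK sm om [fo nv]]]] := run_outcome w.
  exists x; split; [exact: sK | exact: fo | ].
  apply: contrapT => nso; apply: (ok m mK); split; first by exists x.
  by move=> [y []]; rewrite sm om => -[<-] _ /nso.
Qed.

Lemma stops_incorrectlyE :
  stops_incorrectly f q r K = ~` stops_correctly f q r K.
Proof.
apply/seteqP; split => w.
- by case=> x [sK _ nso] [y [sK' _ so]]; move: sK' so; rewrite sK => -[<-] /nso.
- move=> nc; have [m [x [_ sK _ _ [fo _]]]] := run_outcome w.
  exists x; split; [exact: sK | exact: fo | move=> so; apply: nc].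
  by exists x; split.
Qed.

End StoppingEvents.

Theorem theorem5p13 (R : realType) (n : nat) (f : 'cV[R]_n.+1 -> R)
    (q : lbncg_params R) (x0 : 'cV[R]_n.+1) (Lg LH flow : R)
    (disp : measure_display) (Omega : measurableType disp)
    (P : probability Omega R) (r : lbncg_process R n.+1 Omega)
    (F : nat -> set (set Omega)) (delta : R) (Cmeo : R -> R -> R)
    (hq : params_ok q) (hM : Mhat_ok f q)
    (hx0 : forall i, 0 < x0 i ord0)
    (hrun : lbncg_run f q x0 r)
    (hLg : 0 < Lg) (hLH : 0 < LH) (h1 : assumption1 f q r Lg LH)
    (h2 : assumption2 f flow)
    (hdelta : 0 <= delta < 1) (hF : history f q r F)
    (h4 : assumption4 P f q r F delta Cmeo) :
  let K := K2bar (eta q) (c_all q LH) (f x0 - flow) `|x0| (min_log x0) in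
  let K2 := K n.+1 (eps_g q) in
  [/\ tildeO (fun m eps => (K m eps)%:R)
             (fun m eps => m%:R * eps `^ (- (1 / 2)) + eps `^ (- (3 / 2))),
      measurable (stops_correctly f q r K2)
      /\ (((1 - delta) ^+ K2)%:E <= P (stops_correctly f q r K2))%E &
      measurable (stops_incorrectly f q r K2)
      /\ (P (stops_incorrectly f q r K2) <= (1 - (1 - delta) ^+ K2)%:E)%E].
Proof.
move=> K K2.
have [hd0 hd1] := andP hdelta.
have mF k : F k `<=` measurable by have [_ h _ _ _] := hF k.
have sF k : sigma_algebra setT (F k) by have [h _ _ _ _] := hF k.
pose fast k := [set w | (hv r k w <= n_meo n.+1 (Cmeo delta (eps_H q)) (eps_H q))%N].
(* The history contains the level sets of [hv], of which this event is a countable union. *)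
have mfast k : measurable (fast k).
  have -> : fast k = \bigcup_(m in
      [set m | (m <= n_meo n.+1 (Cmeo delta (eps_H q)) (eps_H q))%N])
        [set w | hv r k w = m].
    apply/seteqP; split => w /=; first by move=> h; exists (hv r k w).
    by move=> [m /= hm e]; rewrite /fast /= e.
  apply: bigcup_measurable => m _; apply: (mF k.+1).
  by have [_ _ _ _ [_ h]] := hF k.
have corr := stops_correctlyE hq hM hx0 hrun hLH h1 h2.
have mc : measurable (stops_correctly f q r K2).
  rewrite [stops_correctly _ _ _ _]corr; apply: (mF K2).
  apply: (F_no_failure sF) => k; first by have [] := hF k.
    by have [] := hF k.
  by have [_ _ _ _ []] := hF k.
have Pc : (((1 - delta) ^+ K2)%:E <= P (stops_correctly f q r K2))%E.
  rewrite [stops_correctly _ _ _ _]corr.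
  apply: (no_failure_ge (fast := fast) hdelta sF mF) => //.
  - by move=> k; have [] := hF k.
  - by move=> k; have [] := hF k.
  - by move=> k; have [_ _ _ _ []] := hF k.
  - by have [_ h] := h4.
have incorr := stops_incorrectlyE hq hM hx0 hrun hLH h1 h2.
split; last 1 first.
- rewrite [stops_incorrectly _ _ _ _]incorr; split; first exact: measurableC.
  by rewrite probability_setC // EFinB leeB.
- apply: tildeO_K2bar; [by have [_ [_ /andP[]]] := hq|exact: c_all_gt0|exact: normr_ge0].
- by split.
Qed.
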